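(* Let $a_n>0$ and $b_n\in\mathbb{R}$ ($n\ge1$) be the parameters of a Jacobi matrix $J$ and let $p_n$ be the associated orthonormal polynomials. Consider the conditions $$\text{(A)}\quad \sum_{n=1}^\infty |a_n-1|^2+|b_n|^2<\infty ,$$ $$\text{(B)}\quad \lim_{N\to\infty}\sum_{n=1}^N\log(a_n)\ \text{ exists (and is finite)},$$ $$\text{(C)}\quad \lim_{N\to\infty}\sum_{n=1}^N b_n\ \text{ exists (and is finite)}.$$ If for some $\varepsilon>0$ the sequence $z^np_n(z+z^{-1})$ converges, as $n\to\infty$, uniformly on compact subsets of $\{z\in\mathbb{C}:0<|z|<\varepsilon\}$ to a limit that is non-zero at every point of this set, then (A), (B) and (C) hold. Conversely, if (A), (B) and (C) hold, then $z^np_n(z+z^{-1})$ converges uniformly on compact subsets of $\mathbb{D}=\{z\in\mathbb{C}:|z|<1\}$, and the limit is non-zero at each $z\in\mathbb{D}$ with $z\ne0$ for which $z+z^{-1}$ is not an eigenvalue of $J$.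
   Context: The Jacobi matrix with parameters $a_n>0$, $b_n\in\mathbb{R}$ is the operator on $\ell^2(\mathbb{Z}_+)$, $\mathbb{Z}_+=\{1,2,\dots\}$, given by the tridiagonal matrix $$J=\begin{pmatrix} b_1&a_1&0&0&\cdots\\ a_1&b_2&a_2&0&\cdots\\ 0&a_2&b_3&a_3&\cdots\\ \vdots&\vdots&\vdots&\vdots&\ddots\end{pmatrix}.$$ The polynomials $p_n(E)$, $n\ge0$, are the orthonormal polynomials for the spectral measure of $J$ and the vector $\delta_1$; they satisfy $p_0=1$, $p_{-1}=0$ and $$E\,p_n(E)=a_{n+1}p_{n+1}(E)+b_{n+1}p_n(E)+a_np_{n-1}(E),\qquad n\ge0,$$ (the last term being absent for $n=0$), and are determined by this recursion. The function $z^np_n(z+z^{-1})$ is a polynomial in $z$ and is understood at $z=0$ accordingly. *)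

(* Defs.v *)
From HB Require Import structures.
From mathcomp Require Import all_boot all_order all_algebra.
From mathcomp Require Import complex.
From mathcomp Require Import all_classical all_reals all_analysis.

Set Implicit Arguments.
Unset Strict Implicit.
Unset Printing Implicit Defensive.

Import Order.TTheory GRing.Theory Num.Theory.
Import numFieldNormedType.Exports.

Local Open Scope classical_set_scope.
Local Open Scope complex_scope.
Local Open Scope ring_scope.

(* All sequences are indexed from 0: [a k], [b k] stand for the Jacobi
   parameters a_{k+1}, b_{k+1}, and [u k] for the component u_{k+1} of a vector
   of l^2(Z_+).  In particular [series b N] is b_1 + ... + b_N. *)

(* E p_n = a_{n+1} p_{n+1} + b_{n+1} p_n + a_n p_{n-1}, solved for p_{n+1}. *)
Fixpoint orthonormal_poly (R : realType) (a b : nat -> R) (n : nat) : {poly R} :=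
  if n is m.+1 then
    (a m)^-1 *: (('X - (b m)%:P) * orthonormal_poly a b m
                 - if m is l.+1 then a l *: orthonormal_poly a b l else 0)
  else 1.

(* The polynomial z^n p_n(z + z^-1), obtained from
   z^n (z + z^-1)^k = (z^2 + 1)^k z^(n-k); see [scaled_polyE]. *)
Definition scaled_poly (R : realType) (a b : nat -> R) (n : nat) : {poly R[i]} :=
  \sum_(k < n.+1)
    ((orthonormal_poly a b n)`_k)%:C *: (('X^2 + 1) ^+ k * 'X^(n - k)).

Definition square_summable (R : realType) (u : nat -> R[i]) : Prop :=
  cvgn (series (fun k => Normc.normc (u k) ^+ 2)).

Definition jacobi_op (R : realType) (a b : nat -> R) (u : nat -> R[i]) :
    nat -> R[i] :=
  fun n => (if n is m.+1 then (a m)%:C * u m else 0)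
           + (b n)%:C * u n + (a n)%:C * u n.+1.

(* [u] is in the (maximal) domain of J, since J u = lambda u is again in l^2. *)
Definition jacobi_eigenvalue (R : realType) (a b : nat -> R) (lambda : R[i]) :
    Prop :=
  exists u : nat -> R[i],
    [/\ square_summable u,
        exists n, u n != 0
      & forall n, jacobi_op a b u n = lambda * u n].

(* Stated over a numFieldType so that the topology of R[i] is the one the
   library attaches to every numFieldType. *)
Definition cvg_unif_on_compacts (K : numFieldType) (D : set K)
    (F : nat -> K -> K) (g : K -> K) : Prop :=
  forall A : set K, compact A -> A `<=` D -> {uniform A, F @ \oo --> g}.

Definition condA (R : realType) (a b : nat -> R) : Prop :=
  cvgn (series (fun n => `|a n - 1| ^+ 2 + `|b n| ^+ 2)).

Definition condB (R : realType) (a : nat -> R) : Prop :=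
  cvgn (series (fun n => ln (a n))).

Definition condC (R : realType) (b : nat -> R) : Prop := cvgn (series b).

Lemma orthonormal_poly_rec (R : realType) (a b : nat -> R) (n : nat) :
  a n != 0 ->
  'X * orthonormal_poly a b n =
    a n *: orthonormal_poly a b n.+1 + b n *: orthonormal_poly a b n
    + (if n is m.+1 then a m *: orthonormal_poly a b m else 0).
Proof.
move=> an0; rewrite [orthonormal_poly a b n.+1]/= scalerA divff// scale1r.
by rewrite mulrBl mul_polyC addrAC subrK subrK.
Qed.

Lemma size_orthonormal_poly (R : realType) (a b : nat -> R) (n : nat) :
  (size (orthonormal_poly a b n) <= n.+1)%N.
Proof.
elim/ltn_ind: n => -[|n] IH; first by rewrite /= size_poly1.
rewrite [orthonormal_poly _ _ _]/=; apply: leq_trans (size_scale_leq _ _) _.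
apply: leq_trans (size_polyD _ _) _; rewrite geq_max size_polyN.
apply/andP; split.
  by apply: leq_trans (size_polyMleq _ _) _; rewrite size_XsubC; exact: IH.
case: n IH => [|n] IH; first by rewrite size_poly0.
apply: leq_trans (size_scale_leq _ _) _.
have IHn : (size (orthonormal_poly a b n) <= n.+1)%N by exact: IH.
by rewrite (leq_trans IHn)// ltnW.
Qed.

Lemma scaled_polyE (R : realType) (a b : nat -> R) (n : nat) (z : R[i]) :
  z != 0 ->
  (scaled_poly a b n).[z] =
    z ^+ n * (map_poly (real_complex R) (orthonormal_poly a b n)).[z + z^-1].
Proof.
move=> z0; rewrite /scaled_poly horner_sum.
rewrite (@horner_coef_wide _ n.+1); last first.
  by rewrite size_map_poly size_orthonormal_poly.
rewrite mulr_sumr; apply: eq_bigr => k _.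
rewrite coef_map /= hornerE hornerM horner_exp hornerD !hornerXn hornerC.
rewrite [RHS]mulrCA; congr (_ * _).
have -> : z ^+ n = z ^+ k * z ^+ (n - k) by rewrite -exprD subnKC// -ltnS.
by rewrite mulrAC -exprMn mulrDr divff// expr2.
Qed.

(* Main.v *)
(* Both directions work with the three-term recursion of the monic multiples F_n
   of f_n(z) = z^n p_n(z + 1/z):
     F_{n+2} = (1 + z^2 - b_{n+2} z) F_{n+1} - a_{n+1}^2 z^2 F_n,
   with f_n = F_n / (a_1 ... a_n).

   From convergence to (A), (B), (C): the recursion at z = r and z = -r shows
   that a and b are bounded, so all f_n are zero-free on a fixed small disc.
   The minimum modulus principle then keeps f_n(0) = 1 / (a_1 ... a_n) away
   from 0, and the Taylor coefficients of f_n of order 0, 1, 2 converge by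
   Cauchy's estimate.  Order 0 gives (B), order 1 gives (C), and order 2 involves
   the sums of 1 - a_k^2 and of b_k^2; since a^2 - 1 - 2 log a >= (a - 1)^2,
   combining it with (B) gives (A).

   Converse: D_n = F_{n+1} - F_n is damped by z^2, while Q_n = F_{n+1} - z^2 F_n
   satisfies Q_{n+1} = (1 - gamma_n) Q_n + delta_n D_n, where gamma_n is square
   summable and conditionally summable.  After multiplication by
   exp(gamma_0 + ... + gamma_{n-1}) the factor 1 - gamma_n becomes
   1 + O(|gamma_n|^2), and Q_n converges uniformly.  If the limit vanishes at z,
   D dominates Q, so F_n = O(s^n) for every s > |z|^2; then p_n(z + 1/z)
   decays exponentially and is an eigenvector. *)
Require Import Defs.
From HB Require Import structures.
From mathcomp Require Import all_boot all_order all_algebra.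
From mathcomp Require Import complex.
From mathcomp Require Import all_classical all_reals all_analysis.
From mathcomp Require Import cyclic separable cyclotomic.
From mathcomp Require Import zify ring lra.

Set Implicit Arguments.
Unset Strict Implicit.
Unset Printing Implicit Defensive.

Import Order.TTheory GRing.Theory Num.Theory.
Import numFieldNormedType.Exports.

Local Open Scope classical_set_scope.
Local Open Scope complex_scope.
Local Open Scope ring_scope.

(** * Real sequences *)

(** Conditions (B) and (C) give only conditional convergence and (A) only square summability, so a
    bound on |Q_n| + |D_n| that is linear in |gamma_n| would not close. Squares do: the coupling of
    Q and D yields cross terms k_n |Q_n| |D_n| with k_n = |b_{n+2}| + |a_{n+1}^2 - 1|, and half of
    the damping of D absorbs them up to errors k_n^2 (|Q_n|^2 + |D_n|^2), which are summable. The
    sum of the two squares then gives boundedness and their difference gives the dichotomy behind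
    the eigenvector. In the other direction nothing is assumed at z = 0, although the three
    conditions are read off at 0. Since every f_n is a polynomial, its values on one circle suffice,
    and sums or products over roots of unity replace contour integrals. The lower bound at 0 is
    indispensable: convergence of 1 / (a_1 ... a_n) alone allows the limit 0. The hypothesis on the
    punctured disc does not directly exclude zeros of the individual f_n near 0; this is why bounds
    on a and b have to come first. *)

Lemma growth_bound (R : realType) (W t : nat -> R) :
  0 <= W 0%N -> (forall n, 0 <= W n) -> (forall n, W n.+1 <= (1 + t n) * W n) ->
  forall n, W n <= W 0%N * expR (series t n).
Proof.
move=> W0 Wge0 Wrec; elim=> [|n IH]; first by rewrite seriesEnat /= big_geq// expR0 mulr1.
apply: le_trans (Wrec n) _.
rewrite seriesSr expRD mulrA [X in X <= _]mulrC.
apply: le_trans (_ : W n * expR (t n) <= _).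
  by apply: ler_wpM2l => //; exact: expR_ge1Dx.
by rewrite ler_wpM2r// expR_ge0.
Qed.

(** Convexity of the square, applied to q y + (1 - q) (v / (1 - q)), keeps the coefficient of y^2 at
    q < 1; the price is the factor 1 / (1 - q) on v^2. *)
Lemma decay_sqr (R : realType) (q C k x y y' : R) :
  0 <= q -> q < 1 -> 0 <= y' ->
  y' <= q * y + C * k * (x + y) ->
  y' ^+ 2 <= q * y ^+ 2 + 2 * C ^+ 2 * (1 - q)^-1 * k ^+ 2 * (x ^+ 2 + y ^+ 2).
Proof.
move=> q0 q1 y'0 hy.
have p0 : 0 < 1 - q by rewrite subr_gt0.
set u := (1 - q)^-1.
have u0 : 0 < u by rewrite invr_gt0.
set v := C * k * (x + y) in hy.
have h1 : y' ^+ 2 <= (q * y + v) ^+ 2.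
  by rewrite !expr2; apply: ler_pM.
have h2 : (q * y + v) ^+ 2 <= q * y ^+ 2 + u * v ^+ 2.
  rewrite -subr_ge0.
  have -> : q * y ^+ 2 + u * v ^+ 2 - (q * y + v) ^+ 2 = q * u * ((1 - q) * y - v) ^+ 2.
    by rewrite /u; field; rewrite gt_eqF.
  by apply: mulr_ge0; [apply: mulr_ge0 => //; exact: ltW|exact: sqr_ge0].
apply: le_trans h1 (le_trans h2 _); rewrite lerD2l.
have -> : 2 * C ^+ 2 * u * k ^+ 2 * (x ^+ 2 + y ^+ 2) =
   u * v ^+ 2 + u * (C * k * (x - y)) ^+ 2 by rewrite /v; ring.
by rewrite lerDl; apply: mulr_ge0; [exact: ltW|exact: sqr_ge0].
Qed.

(** Young's inequality, weighted so that the y^2 term costs exactly half of the damping 1 - q. *)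
Lemma cross_term_le (R : realType) (q C k x y : R) : q < 1 ->
  2 * C * k * x * y <=
    (1 - q) / 2 * y ^+ 2 + 2 * C ^+ 2 * (1 - q)^-1 * k ^+ 2 * x ^+ 2.
Proof.
move=> q1; have p0 : 0 < 1 - q by rewrite subr_gt0.
rewrite -subr_ge0.
have -> : (1 - q) / 2 * y ^+ 2 + 2 * C ^+ 2 * (1 - q)^-1 * k ^+ 2 * x ^+ 2 - 2 * C * k * x * y =
   (1 - q)^-1 / 2 * ((1 - q) * y - 2 * C * k * x) ^+ 2.
  by field; rewrite gt_eqF.
by apply: mulr_ge0; [rewrite divr_ge0// invr_ge0 ltW|exact: sqr_ge0].
Qed.

(* Dominates the pair (|Q_n|, |D_n|) independently of z, so that convergence of
   the first component gives uniform convergence of Q_n. *)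
Fixpoint majorant (R : realType) (q C x0 y0 : R) (k : nat -> R) (n : nat) : R * R :=
  if n is m.+1 then
    let x := (majorant q C x0 y0 k m).1 in
    let y := (majorant q C x0 y0 k m).2 in
    (x + C * k m * (k m * x + y), q * y + C * k m * (x + y))
  else (x0, y0).

Lemma series_ge0_le_lim (R : realType) (u : nat -> R) :
  (forall n, 0 <= u n) -> cvgn (series u) -> forall n, series u n <= limn (series u).
Proof.
move=> u0 cu n; apply: nondecreasing_cvgn_le => //.
by apply: nondecreasing_series => k _.
Qed.

Lemma bounded_series_cvg (R : realType) (u : nat -> R) (B : R) :
  (forall n, 0 <= u n) -> (forall n, series u n <= B) -> cvgn (series u).
Proof.
move=> u0 uB; apply: nondecreasing_is_cvgn.
  by apply: nondecreasing_series => k _.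
by exists B => _ [n _ <-].
Qed.

Lemma majorant_ge0 (R : realType) (q C x0 y0 : R) (k : nat -> R) :
  0 <= q -> 0 <= C -> 0 <= x0 -> 0 <= y0 -> (forall n, 0 <= k n) ->
  forall n, 0 <= (majorant q C x0 y0 k n).1 /\ 0 <= (majorant q C x0 y0 k n).2.
Proof.
move=> q0 C0 x00 y00 k0; elim=> //= n [hx hy]; split.
  by rewrite addr_ge0// mulr_ge0// ?mulr_ge0// addr_ge0// mulr_ge0.
by rewrite addr_ge0// ?mulr_ge0// ?mulr_ge0// addr_ge0.
Qed.

Lemma series_ge_term (R : realType) (u : nat -> R) :
  (forall n, 0 <= u n) -> forall n, u n <= series u n.+1.
Proof.
move=> u0 n; rewrite seriesSr lerDr.
have := @nondecreasing_series R u xpredT 0%N (fun i _ _ => u0 i) 0%N n (leq0n _).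
by rewrite big_geq.
Qed.

Lemma sqr_summable_bounded (R : realType) (k : nat -> R) :
  (forall n, 0 <= k n) -> cvgn (series (fun n => k n ^+ 2)) ->
  exists2 M : R, 0 <= M & forall n, k n <= M.
Proof.
move=> k0 ck; have s0 n : 0 <= k n ^+ 2 by exact: sqr_ge0.
have hL n := series_ge0_le_lim s0 ck n.
have L0 : 0 <= limn (series (fun n => k n ^+ 2)).
  by have := hL 0%N; rewrite seriesEnat /= big_geq.
exists (1 + limn (series (fun n => k n ^+ 2))); first by rewrite addr_ge0.
move=> n; have h := le_trans (series_ge_term s0 n) (hL n.+1).
have := sqr_ge0 (k n - 1); nra.
Qed.

(* The energy x^2 + y^2 grows by a factor 1 + O(k^2) per step, because the
   cross term 2 C k x y is absorbed by the damping of y. *)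
Lemma majorant_energy (R : realType) (q C M k x y : R) :
  0 <= q -> q < 1 -> 0 <= C -> 0 <= k -> k <= M -> 0 <= x -> 0 <= y ->
  (x + C * k * (k * x + y)) ^+ 2 + (q * y + C * k * (x + y)) ^+ 2
    + (1 - q) / 2 * y ^+ 2 <=
  (1 + (2 * C + 2 * C ^+ 2 * (M ^+ 2 + 1) + 4 * C ^+ 2 * (1 - q)^-1) * k ^+ 2)
    * (x ^+ 2 + y ^+ 2).
Proof.
move=> q0 q1 C0 k0 kM x0 y0.
have p0 : 0 < 1 - q by rewrite subr_gt0.
have hy := decay_sqr (x := x) q0 q1 _ (lexx (q * y + C * k * (x + y))).
have {}hy := hy (addr_ge0 (mulr_ge0 q0 y0) (mulr_ge0 (mulr_ge0 C0 k0) (addr_ge0 x0 y0))).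
set u := (1 - q)^-1 in hy *.
have u0 : 0 < u by rewrite invr_gt0.
have h1 := cross_term_le C k x y q1; rewrite -/u in h1.
have kM2 : (k * x) ^+ 2 <= M ^+ 2 * x ^+ 2.
  by rewrite -exprMn ler_sqr ?nnegrE ?mulr_ge0// ?ler_wpM2r// (le_trans k0).
have h2 : (C * k * (k * x + y)) ^+ 2 <= 2 * C ^+ 2 * k ^+ 2 * (M ^+ 2 * x ^+ 2 + y ^+ 2).
  rewrite exprMn exprMn.
  have -> : 2 * C ^+ 2 * k ^+ 2 * (M ^+ 2 * x ^+ 2 + y ^+ 2) =
     (C ^+ 2 * k ^+ 2) * (2 * (M ^+ 2 * x ^+ 2 + y ^+ 2)) by ring.
  apply: ler_wpM2l; first by rewrite mulr_ge0 ?sqr_ge0.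
  have := sqr_ge0 (k * x - y); nra.
have -> : (x + C * k * (k * x + y)) ^+ 2 = x ^+ 2 + 2 * C * k ^+ 2 * x ^+ 2
     + 2 * C * k * x * y + (C * k * (k * x + y)) ^+ 2 by ring.
have C2 : 0 <= C ^+ 2 by exact: sqr_ge0.
have k2 : 0 <= k ^+ 2 by exact: sqr_ge0.
have x2 : 0 <= x ^+ 2 by exact: sqr_ge0.
have y2 : 0 <= y ^+ 2 by exact: sqr_ge0.
have M2 : 0 <= M ^+ 2 by exact: sqr_ge0.
have {}u0 := ltW u0.
have g (a b c d : R) : 0 <= a -> 0 <= b -> 0 <= c -> 0 <= d -> 0 <= 2 * a * b * (c * d).
  by move=> *; rewrite !mulr_ge0.
have g1 := g _ _ _ _ C0 k2 ler01 y2.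
have g2 := g _ _ _ _ C2 k2 ler01 x2.
have g3 := g _ _ _ _ C2 k2 M2 y2.
have g4 := g _ _ _ _ C2 u0 k2 y2.
have -> : (1 + (2 * C + 2 * C ^+ 2 * (M ^+ 2 + 1) + 4 * C ^+ 2 * u) * k ^+ 2) * (x ^+ 2 + y ^+ 2)
 = x ^+ 2 + y ^+ 2 + 2 * C * k ^+ 2 * x ^+ 2 + 2 * C * k ^+ 2 * y ^+ 2 
   + 2 * C ^+ 2 * k ^+ 2 * (M ^+ 2 * x ^+ 2 + y ^+ 2) + 2 * C ^+ 2 * k ^+ 2 * (x ^+ 2) 
   + 2 * C ^+ 2 * k ^+ 2 * (M ^+ 2 * y ^+ 2) + 2 * C ^+ 2 * u * k ^+ 2 * x ^+ 2
   + 2 * C ^+ 2 * u * k ^+ 2 * y ^+ 2 + 2 * C ^+ 2 * u * k ^+ 2 * (x ^+ 2 + y ^+ 2) by ring.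
lra.
Qed.

Lemma cvg_sqr0 (R : realType) (u : nat -> R) :
  (fun n => u n ^+ 2) @ \oo --> (0 : R) -> u @ \oo --> (0 : R).
Proof.
move=> h; apply/norm_cvg0P.
have -> : (fun n => `|u n|) = (fun n => Num.sqrt (u n ^+ 2)).
  by apply/funext => n; rewrite sqrtr_sqr.
rewrite -[X in _ --> X](@sqrtr0 R).
by apply: (continuous_cvg _ _ h); exact: sqrt_continuous.
Qed.

(** The energy stays bounded by [growth_bound], so the nondecreasing first component converges. The
    half of the damping left over in [majorant_energy] makes the squares of the second component
    summable, hence that component tends to 0. *)
Lemma majorant_cvg (R : realType) (q C x0 y0 : R) (k : nat -> R) :
  0 <= q -> q < 1 -> 0 <= C -> 0 <= x0 -> 0 <= y0 -> (forall n, 0 <= k n) ->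
  cvgn (series (fun n => k n ^+ 2)) ->
  cvgn (fun n => (majorant q C x0 y0 k n).1) /\
  (fun n => (majorant q C x0 y0 k n).2) @ \oo --> (0 : R).
Proof.
move=> q0 q1 C0 x00 y00 k0 ck.
have [M M0 kM] := sqr_summable_bounded k0 ck.
set X := fun n => (majorant q C x0 y0 k n).1.
set Y := fun n => (majorant q C x0 y0 k n).2.
have [X0 Y0] : (forall n, 0 <= X n) /\ (forall n, 0 <= Y n).
  by split=> n; have [] := majorant_ge0 q0 C0 x00 y00 k0 n.
set T := 2 * C + 2 * C ^+ 2 * (M ^+ 2 + 1) + 4 * C ^+ 2 * (1 - q)^-1.
have p0 : 0 < 1 - q by rewrite subr_gt0.
have T0 : 0 <= T.
  by rewrite !addr_ge0 ?mulr_ge0 ?addr_ge0 ?exprn_ge0// invr_ge0 ltW.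
pose W n := X n ^+ 2 + Y n ^+ 2.
have W0 n : 0 <= W n by rewrite addr_ge0 ?sqr_ge0.
have step n : W n.+1 + (1 - q) / 2 * Y n ^+ 2 <= (1 + T * k n ^+ 2) * W n.
  exact: (majorant_energy q0 q1 C0 (k0 n) (kM n) (X0 n) (Y0 n)).
have Wstep n : W n.+1 <= (1 + T * k n ^+ 2) * W n.
  apply: le_trans (step n); rewrite lerDl mulr_ge0 ?sqr_ge0// divr_ge0// ltW//.
have s0 n : 0 <= k n ^+ 2 by exact: sqr_ge0.
have sE n : series (fun n => T * k n ^+ 2) n = T * series (fun n => k n ^+ 2) n.
  by rewrite !seriesEnat /= mulr_sumr.
pose L := limn (series (fun n => k n ^+ 2)).
have sL n : series (fun n => k n ^+ 2) n <= L by exact: series_ge0_le_lim.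
pose B := W 0%N * expR (T * L).
have WB n : W n <= B.
  apply: le_trans (growth_bound (W0 0%N) W0 Wstep n) _.
  by apply: ler_wpM2l => //; rewrite ler_expR sE ler_wpM2l.
have B0 : 0 <= B by exact: le_trans (W0 0%N) (WB 0%N).
split.
  apply: nondecreasing_is_cvgn.
    apply/nondecreasing_seqP => n; rewrite /X /= lerDl mulr_ge0 ?mulr_ge0//.
    by rewrite addr_ge0 ?mulr_ge0//; [exact: X0|exact: Y0].
  exists (1 + B) => _ [n _ <-].
  have h : X n ^+ 2 <= B by apply: le_trans (WB n); rewrite lerDl sqr_ge0.
  have := sqr_ge0 (X n - 1); nra.
apply: cvg_sqr0; apply: cvg_series_cvg_0.
apply: (@bounded_series_cvg _ _ ((W 0%N + T * B * L) * (2 / (1 - q)))).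
  by move=> n; exact: sqr_ge0.
(* The energy inequality summed over the steps, with [W] replaced by its bound [B] in the error
   terms. *)
have key n : W n + (1 - q) / 2 * series (fun n => Y n ^+ 2) n <=
    W 0%N + T * B * series (fun n => k n ^+ 2) n.
  elim: n => [|n IH]; first by rewrite !seriesEnat /= !big_geq// !mulr0.
  rewrite !seriesSr !mulrDr /=.
  have h : T * k n ^+ 2 * W n <= T * B * k n ^+ 2.
    by rewrite [X in _ <= X]mulrAC ler_wpM2l ?mulr_ge0.
  have := step n; rewrite mulrDl mul1r; move: IH => /=; lra.
move=> n; rewrite -invf_div ler_pdivlMr ?divr_gt0// mulrC.
have h : T * B * series (fun n => k n ^+ 2) n <= T * B * L.
  by rewrite ler_wpM2l// mulr_ge0.
apply: le_trans (_ : _ <= W n + (1 - q) / 2 * series (fun n => Y n ^+ 2) n) _.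
  by rewrite lerDr.
by apply: le_trans (key n) _; rewrite lerD2l.
Qed.

(** Counterpart of [majorant_energy] for the indefinite form x^2 - y^2: up to O(k^2) errors it does
    not decrease, and half of the damping of y remains as a gain. *)
Lemma decay_step (R : realType) (q C k x y x' y' : R) :
  0 <= q -> q < 1 -> 0 <= C -> 0 <= k -> 0 <= x -> 0 <= y -> 0 <= x' -> 0 <= y' ->
  x - C * k * (k * x + y) <= x' -> y' <= q * y + C * k * (x + y) ->
  x ^+ 2 - y ^+ 2 + (1 - q) / 2 * y ^+ 2
    - (2 * C + 4 * C ^+ 2 * (1 - q)^-1) * k ^+ 2 * (x ^+ 2 + y ^+ 2)
  <= x' ^+ 2 - y' ^+ 2.
Proof.
move=> q0 q1 C0 k0 x0 y0 x'0 y'0 hx hy.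
have {hy} := decay_sqr q0 q1 y'0 hy.
have p0 : 0 < 1 - q by rewrite subr_gt0.
set u := (1 - q)^-1 => hy.
have u0 : 0 < u by rewrite invr_gt0.
have h1 := cross_term_le C k x y q1; rewrite -/u in h1.
(* With w the subtracted term, x - w may be negative, so x - w <= x' cannot simply be squared. If x'
   < x, then x^2 - x'^2 = (x - x') (x + x') <= 2 x w. *)
have h2 : x ^+ 2 - 2 * x * (C * k * (k * x + y)) <= x' ^+ 2.
  have w0 : 0 <= C * k * (k * x + y) by apply: mulr_ge0; [apply: mulr_ge0|rewrite addr_ge0// mulr_ge0].
  case: (leP x x') => xx'.
    apply: le_trans (_ : x ^+ 2 <= _); first by rewrite gerBl (mulr_ge0 (mulr_ge0 _ x0) w0).
    by rewrite ler_sqr.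
  set w := C * k * (k * x + y) in w0 hx *.
  have : 0 <= (x - x') * (x - x') by rewrite -expr2 sqr_ge0.
  have : 0 <= x * (w - (x - x')) by rewrite mulr_ge0//; lra.
  have : 0 <= (x - x') * x' by rewrite mulr_ge0//; lra.
  rewrite !expr2; nra.
have C2 : 0 <= C ^+ 2 by exact: sqr_ge0.
have k2 : 0 <= k ^+ 2 by exact: sqr_ge0.
have y2 : 0 <= y ^+ 2 by exact: sqr_ge0.
have g0 : 0 <= 2 * C * (k ^+ 2 * y ^+ 2).
  by apply: mulr_ge0; apply: mulr_ge0.
have g1 : 0 <= 2 * C ^+ 2 * u * (k ^+ 2 * y ^+ 2).
  by apply: mulr_ge0; [apply: mulr_ge0; [apply: mulr_ge0|exact: ltW]|apply: mulr_ge0].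
have -> : x ^+ 2 - y ^+ 2 + (1 - q) / 2 * y ^+ 2
    - (2 * C + 4 * C ^+ 2 * u) * k ^+ 2 * (x ^+ 2 + y ^+ 2) =
  (x ^+ 2 - 2 * x * (C * k * (k * x + y))) + (2 * C * k * x * y -
    ((1 - q) / 2 * y ^+ 2 + 2 * C ^+ 2 * u * k ^+ 2 * x ^+ 2)) -
   (q * y ^+ 2 + 2 * C ^+ 2 * u * k ^+ 2 * (x ^+ 2 + y ^+ 2))
   - 2 * C * (k ^+ 2 * y ^+ 2) - 2 * C ^+ 2 * u * (k ^+ 2 * y ^+ 2) by field.
lra.
Qed.

Lemma series_tail (R : realType) (t : nat -> R) (e : R) :
  (forall n, 0 <= t n) -> cvgn (series t) -> 0 < e ->
  exists N, forall m n, (N <= m)%N -> (m <= n)%N -> series t n - series t m <= e.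
Proof.
move=> t0 ct e0.
have mono : {homo series t : i j / (i <= j)%N >-> i <= j}.
  by apply: nondecreasing_series => k _.
have [N _ HN] : \forall n \near \oo, limn (series t) - e < series t n.
  by apply: (cvgr_gt (limn (series t)) ct); rewrite gtrBl.
exists N => m n Nm mn.
have := HN _ Nm; have := series_ge0_le_lim t0 ct n => /=; lra.
Qed.

(** If x^2 - y^2 were positive at a late index, it would keep at least half of that value forever,
    against x tending to 0. So y dominates x eventually, and its own recursion contracts by q + 2 C
    k_n, which is at most r once k_n is small. *)
Lemma decay_dichotomy (R : realType) (q C r : R) (k x y : nat -> R) :
  0 <= q -> q < 1 -> 0 <= C -> q < r ->
  (forall n, 0 <= k n) -> (forall n, 0 <= x n) -> (forall n, 0 <= y n) ->
  cvgn (series (fun n => k n ^+ 2)) -> x @ \oo --> (0 : R) ->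
  (forall n, x n - C * k n * (k n * x n + y n) <= x n.+1) ->
  (forall n, y n.+1 <= q * y n + C * k n * (x n + y n)) ->
  exists N, forall n, (N <= n)%N -> x n <= y n /\ y n.+1 <= r * y n.
Proof.
move=> q0 q1 C0 qr k0 x0 y0 ck xto0 hx hy.
pose T := 2 * C + 4 * C ^+ 2 * (1 - q)^-1.
have p0 : 0 < 1 - q by rewrite subr_gt0.
have T0 : 0 <= T.
  by rewrite addr_ge0 ?mulr_ge0 ?exprn_ge0// invr_ge0 ltW.
pose t n := T * k n ^+ 2.
have t0 n : 0 <= t n by rewrite mulr_ge0// sqr_ge0.
have ct : cvgn (series t).
  have -> : series t = (fun n => T * series (fun n => k n ^+ 2) n).
    by apply/funext => n; rewrite !seriesEnat /= mulr_sumr.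
  exact: is_cvgMr.
(* A tail below 1/2 keeps the product of the 1 - t_n above 1/2; a tail below (1 - q) / 4 lets the
   spare term (1 - q) / 2 y^2 absorb 2 t_n y^2. *)
have e0 : 0 < Num.min (1/2) ((1 - q) / 4) by rewrite lt_min !divr_gt0.
have [N1 HN1] := series_tail t0 ct e0.
have kto0 : k @ \oo --> (0 : R) by apply: cvg_sqr0; exact: cvg_series_cvg_0.
(* Below this threshold 2 C k_n <= r - q; the added 1 only keeps the denominator positive. *)
have rq0 : 0 < (r - q) / (2 * C + 1).
  by rewrite divr_gt0 ?subr_gt0// ltr_wpDl// mulr_ge0.
have [N2 _ HN2] : \forall n \near \oo, k n < (r - q) / (2 * C + 1).
  exact: (cvgr_lt 0 kto0 _ rq0).
pose V n := x n ^+ 2 - y n ^+ 2.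
have Vstep n : (N1 <= n)%N -> V n * (1 - t n) <= V n.+1.
  move=> Nn.
  have tn : t n <= (1 - q) / 4.
    have := HN1 n n.+1 Nn (leqnSn n); rewrite seriesSr addrC addKr le_min.
    by case/andP.
  have := decay_step q0 q1 C0 (k0 n) (x0 n) (y0 n) (x0 n.+1) (y0 n.+1) (hx n) (hy n).
  apply: le_trans; rewrite -/T -/(t n) /V -subr_ge0.
  have -> : x n ^+ 2 - y n ^+ 2 + (1 - q) / 2 * y n ^+ 2 - t n * (x n ^+ 2 + y n ^+ 2) -
    (x n ^+ 2 - y n ^+ 2) * (1 - t n) = 2 * ((1 - q) / 4 - t n) * y n ^+ 2 by field.
  by rewrite mulr_ge0 ?sqr_ge0// mulr_ge0// subr_ge0.
have Vle0 m : (N1 <= m)%N -> V m <= 0.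
  move=> Nm; rewrite leNgt; apply/negP => Vm.
  (* The product of the factors 1 - t_n is at least 1 minus the sum of the t_n. *)
  have low j : V m * (1 - (series t (m + j)%N - series t m)) <= V (m + j)%N.
    elim: j => [|j IH]; first by rewrite addn0 subrr subr0 mulr1.
    have Nj : (N1 <= m + j)%N by rewrite (leq_trans Nm)// leq_addr.
    rewrite addnS; apply: le_trans (Vstep _ Nj).
    have := HN1 m (m + j)%N Nm (leq_addr _ _); rewrite le_min => /andP[s1 _].
    have := HN1 (m + j)%N (m + j).+1 Nj (leqnSn _); rewrite le_min => /andP[s2 _].
    have s3 : 0 <= series t (m + j)%N - series t m.
      rewrite subr_ge0; apply: nondecreasing_series => //; exact: leq_addr.
    move: s2 IH; rewrite seriesSr [_ + t _ - _]addrC addKr.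
    set s := series t (m + j)%N in s1 s3 *; move=> s2 IH.
    have h1 : 0 <= 1 - t (m + j)%N by lra.
    apply: le_trans (ler_wpM2r h1 IH).
    rewrite -mulrA; apply: ler_wpM2l; first exact: ltW.
    have := mulr_ge0 s3 (t0 (m + j)%N). lra.
  (* The bound x < 1 gives x^2 <= x, so x < V_m / 2 contradicts V_m / 2 <= V <= x^2. *)
  have [N3 _ HN3] : \forall n \near \oo, x n < Num.min 1 (V m / 2).
    apply: (cvgr_lt 0 xto0); by rewrite lt_min ltr01 divr_gt0.
  have := HN3 (m + N3)%N (leq_addl _ _); rewrite /= lt_min => /andP[x1 x2].
  have := HN1 m (m + N3)%N Nm (leq_addr _ _); rewrite le_min => /andP[s1 _].
  have := low N3; rewrite {2}/V.
  have h : V m * (1 / 2) <= V m * (1 - (series t (m + N3)%N - series t m)).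
    by apply: ler_wpM2l; [exact: ltW|lra].
  have := sqr_ge0 (y (m + N3)%N).
  have : x (m + N3)%N ^+ 2 <= x (m + N3)%N.
    by rewrite expr2; have := mulr_ge0 (x0 (m + N3)%N) (_ : 0 <= 1 - x (m + N3)%N); lra.
  lra.
exists (maxn N1 N2) => n; rewrite geq_max => /andP[n1 n2].
have xy : x n <= y n.
  by rewrite -ler_sqr ?nnegrE// -subr_le0; exact: Vle0.
split=> //; apply: le_trans (hy n) _.
have := HN2 n n2; rewrite /= ltr_pdivlMr; last by rewrite ltr_wpDl// mulr_ge0.
move=> hk.
have h1 : C * k n * (x n + y n) <= C * k n * (2 * y n).
  by rewrite ler_wpM2l ?mulr_ge0//; lra.
have h2 : 0 <= (r - q - k n * (2 * C + 1) + k n) * y n.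
  by rewrite mulr_ge0// addr_ge0// subr_ge0 ltW.
lra.
Qed.

(** * Modulus and exponential on R[i] *)

Local Notation norm := Normc.normc.

Lemma normc_ge0 (R : rcfType) (z : R[i]) : 0 <= norm z.
Proof. by case: z => x y; exact: sqrtr_ge0. Qed.

Lemma normrE (R : rcfType) (z : R[i]) : `|z| = (norm z)%:C.
Proof. by []. Qed.

Lemma normc_real (R : rcfType) (x : R) : norm x%:C = `|x|.
Proof. by rewrite /Normc.normc /= expr0n addr0 sqrtr_sqr. Qed.

Lemma normcX (R : rcfType) (z : R[i]) n : norm (z ^+ n) = norm z ^+ n.
Proof.
elim: n => [|n IH]; first by rewrite !expr0 Normc.normc1.
by rewrite !exprS Normc.normcM IH.
Qed.

Lemma normcB (R : rcfType) (x y : R[i]) : norm (x - y) <= norm x + norm y.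
Proof. by rewrite -[norm y]normcN; exact: le_normcD. Qed.

Lemma distcC (R : rcfType) (x y : R[i]) : norm (x - y) = norm (y - x).
Proof. by rewrite -opprB normcN. Qed.

Lemma normcB_ge (R : rcfType) (x y : R[i]) : norm x - norm y <= norm (x - y).
Proof. by rewrite lerBlDr -{1}(subrK y x) le_normcD. Qed.

Lemma normcD_ge (R : rcfType) (x y : R[i]) : norm x - norm y <= norm (x + y).
Proof. by rewrite -[y in norm (x + y)]opprK -[norm y]normcN normcB_ge. Qed.

Lemma normc_eq0 (R : rcfType) (z : R[i]) : (norm z == 0) = (z == 0).
Proof.
by apply/eqP/eqP => [/Normc.eq0_normc //|->]; exact: Normc.normc0.
Qed.

Lemma normc_gt0 (R : rcfType) (z : R[i]) : (0 < norm z) = (z != 0).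
Proof. by rewrite lt_def normc_ge0 andbT normc_eq0. Qed.

Lemma normc_sqr (R : rcfType) (z : R[i]) : norm z ^+ 2 = complex.Re z ^+ 2 + complex.Im z ^+ 2.
Proof. by case: z => x y /=; rewrite sqr_sqrtr// addr_ge0 ?sqr_ge0. Qed.

Lemma Re_le_normc (R : rcfType) (z : R[i]) : `|complex.Re z| <= norm z.
Proof.
rewrite -ler_sqr ?nnegrE ?normc_ge0// normc_sqr.
by rewrite real_normK ?num_real// lerDl sqr_ge0.
Qed.

Lemma Im_le_normc (R : rcfType) (z : R[i]) : `|complex.Im z| <= norm z.
Proof.
rewrite -ler_sqr ?nnegrE ?normc_ge0// normc_sqr.
by rewrite real_normK ?num_real// lerDr sqr_ge0.
Qed.

Lemma normc_le_ReIm (R : rcfType) (z : R[i]) : norm z <= `|complex.Re z| + `|complex.Im z|.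
Proof.
rewrite -ler_sqr ?nnegrE ?addr_ge0 ?normc_ge0// normc_sqr sqrrD.
rewrite !real_normK ?num_real//.
by have := mulr_ge0 (normr_ge0 (complex.Re z)) (normr_ge0 (complex.Im z)); lra.
Qed.

(** * The complex exponential in polar form and its expansion to second order at 0 *)

Definition cexp (R : realType) (w : R[i]) : R[i] :=
  (expR (complex.Re w))%:C * (cos (complex.Im w) +i* sin (complex.Im w)).

Lemma cexpD (R : realType) (u v : R[i]) : cexp (u + v) = cexp u * cexp v.
Proof.
case: u v => a b [c d]; rewrite /cexp /= expRD cosD sinD rmorphM /=.
rewrite mulrACA; congr (_ * _); apply/eqP; rewrite eq_complex /=; apply/andP; split.
  by apply/eqP; ring.
by apply/eqP; ring.
Qed.

Lemma cexp0 (R : realType) : cexp (0 : R[i]) = 1.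
Proof. by rewrite /cexp /= expR0 cos0 sin0 mul1r. Qed.

Lemma normc_cexp (R : realType) (w : R[i]) : norm (cexp w) = expR (complex.Re w).
Proof.
rewrite /cexp Normc.normcM normc_real ger0_norm ?expR_ge0//.
by rewrite /= cos2Dsin2 sqrtr1 mulr1.
Qed.

Lemma cexpN (R : realType) (w : R[i]) : cexp (- w) * cexp w = 1.
Proof. by rewrite -cexpD addNr cexp0. Qed.

Lemma expR_sub1_le (R : realType) (x : R) : `|expR x - 1| <= `|x| * expR `|x|.
Proof.
have h1 := expR_ge1Dx x.
have h2 := expR_ge1Dx (- x); have h3 := expRxMexpNx_1 x.
have e0 := expR_ge0 x.
case: (lerP 0 x) => x0.
  rewrite (ger0_norm x0) ger0_norm ?subr_ge0; last by lra.
  have := ler_wpM2l e0 h2; lra.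
rewrite (ltr0_norm x0) ltr0_norm; last by rewrite subr_lt0 expR_lt1.
have h4 : 1 <= expR (- x) by lra.
have : - x * 1 <= - x * expR (- x) by rewrite ler_wpM2l; lra.
lra.
Qed.

(** Everything comes from 1 + t <= e^t at t = x and t = -x. For x >= 0 the second case gives e^x - 1
    <= x e^x, which is multiplied by x. *)
Lemma expR_sub1x_le (R : realType) (x : R) :
  `|expR x - 1 - x| <= x ^+ 2 * expR `|x|.
Proof.
have h1 := expR_ge1Dx x.
have h2 := expR_ge1Dx (- x); have h3 := expRxMexpNx_1 x.
have e0 := expR_ge0 x.
rewrite ger0_norm; last by lra.
case: (lerP 0 x) => x0.
  rewrite (ger0_norm x0).
  have h := ler_wpM2l e0 h2.
  have : expR x - 1 <= x * expR x by lra.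
  move=> /(ler_wpM2l x0); rewrite expr2 -mulrA; lra.
rewrite (ltr0_norm x0).
have h5 : 1 <= expR (- x) by lra.
apply: le_trans (_ : x ^+ 2 <= _); last first.
  by rewrite -{1}(mulr1 (x ^+ 2)) ler_wpM2l ?sqr_ge0.
have h6 := ler_wpM2l e0 h2.
have x1 : 0 < 1 - x by lra.
(* Multiplied by 1 - x > 0, the claim for x < 0 reduces to e^x (1 - x) <= 1 and -x^3 >= 0. *)
rewrite -subr_ge0 -(pmulr_rge0 _ x1).
have -> : (1 - x) * (x ^+ 2 - (expR x - 1 - x)) =
    1 - expR x * (1 + - x) + x ^+ 2 * - x by ring.
by rewrite addr_ge0//; [lra|rewrite mulr_ge0 ?sqr_ge0//; lra].
Qed.

(** Mean value inequality on the segment from 0 to y, whichever sign y has. It yields the remainders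
    of sin and cos below, with constants that are not sharp. *)
Lemma lipschitz_le (R : realType) (f df : R -> R) (C y : R) :
  (forall x : R, is_derive x 1 f (df x)) ->
  (forall x : R, `|x| <= `|y| -> `|df x| <= C) -> `|f y - f 0| <= C * `|y|.
Proof.
move=> fdf dC.
have cf (a b : R) : {within `[a, b], continuous f}.
  apply: derivable_within_continuous => x _; exact: (@ex_derive _ _ _ _ _ _ _ (fdf x)).
case: (lerP 0 y) => y0.
  have [c cy ->] := MVT_segment y0 (fun x _ => fdf x) (cf _ _).
  rewrite subr0 normrM ler_wpM2r// dC//.
  by move: cy; rewrite in_itv /= => /andP[c0 cy]; rewrite !ger0_norm.
have [c cy] := MVT_segment (ltW y0) (fun x _ => fdf x) (cf _ _).
rewrite sub0r => e; rewrite distrC e normrM normrN ler_wpM2r// dC//.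
by move: cy; rewrite in_itv /= => /andP[c0 cy]; rewrite !ler0_norm ?lerN2// ltW.
Qed.

Lemma sin_le_norm (R : realType) (x : R) : `|sin x| <= `|x|.
Proof.
rewrite -[sin x]subr0 -{1}sin0 -[X in _ <= X]mul1r.
by apply: (@lipschitz_le _ _ cos) => t _; exact: cos_max.
Qed.

Lemma cos_sub1_le (R : realType) (y : R) : `|cos y - 1| <= y ^+ 2.
Proof.
rewrite -cos0 -(real_normK (num_real y)) expr2.
apply: (@lipschitz_le _ _ (fun x => - sin x)) => x xy.
by rewrite normrN (le_trans (sin_le_norm x)).
Qed.

Lemma sin_subx_le (R : realType) (y : R) : `|sin y - y| <= y ^+ 2.
Proof.
rewrite -(real_normK (num_real y)) expr2.
have -> : sin y - y = (sin y - y) - (sin 0 - 0) by rewrite sin0 !subr0.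
apply: (@lipschitz_le _ (fun x => sin x - x) (fun x => cos x - 1)) => x xy.
apply: le_trans xy; rewrite -cos0 -[X in _ <= X]mul1r.
by apply: (@lipschitz_le _ _ (fun x => - sin x)) => t _; rewrite normrN sin_max.
Qed.

(** Splitting e^x e^(iy) isolates the remainders of the real exponential, of cos and of sin, and the
    mixed term (e^x - 1) y, which is O(|x| |y|). Their sum contributes at most 3 e^G to each square,
    so 4 leaves room. *)
Lemma normc_cexp_sub1 (R : realType) (w : R[i]) (G : R) : norm w <= G ->
  norm (cexp w - 1 - w) <= 4 * expR G * norm w ^+ 2.
Proof.
case: w => x y wG; rewrite normc_sqr -[complex.Re (x +i* y)]/x -[complex.Im (x +i* y)]/y.
have xG : `|x| <= G := le_trans (Re_le_normc (x +i* y)) wG.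
have eG : expR `|x| <= expR G by rewrite ler_expR.
have exG : expR x <= expR G by rewrite ler_expR (le_trans (ler_norm x)).
have G1 : 1 <= expR G by rewrite -expR0 ler_expR (le_trans _ xG).
apply: le_trans (normc_le_ReIm _) _.
have -> : complex.Re (cexp (x +i* y) - 1 - (x +i* y)) =
    (expR x - 1 - x) + expR x * (cos y - 1) by rewrite /=; ring.
have -> : complex.Im (cexp (x +i* y) - 1 - (x +i* y)) =
    expR x * (sin y - y) + (expR x - 1) * y by rewrite /=; ring.
have h1 : `|expR x - 1 - x| <= x ^+ 2 * expR G.
  by apply: le_trans (expR_sub1x_le x) _; rewrite ler_wpM2l ?sqr_ge0.
have h2 : `|expR x * (cos y - 1)| <= expR G * y ^+ 2.
  by rewrite normrM ler_pM// ?cos_sub1_le// ger0_norm ?expR_ge0.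
have h3 : `|expR x * (sin y - y)| <= expR G * y ^+ 2.
  by rewrite normrM ler_pM// ?sin_subx_le// ger0_norm ?expR_ge0.
have h4 : `|(expR x - 1) * y| <= (`|x| * expR G) * `|y|.
  rewrite normrM ler_wpM2r//; apply: le_trans (expR_sub1_le x) _.
  by rewrite ler_wpM2l.
have h5 : expR G * (`|x| * `|y|) <= expR G * (x ^+ 2 + y ^+ 2).
  rewrite ler_wpM2l ?expR_ge0// -(real_normK (num_real x)) -(real_normK (num_real y)).
  have := sqr_ge0 (`|x| - `|y|); have := sqr_ge0 `|x|; have := sqr_ge0 `|y|; lra.
have h6 : 0 <= expR G * x ^+ 2 by rewrite mulr_ge0 ?sqr_ge0 ?expR_ge0.
have h7 : 0 <= expR G * y ^+ 2 by rewrite mulr_ge0 ?sqr_ge0 ?expR_ge0.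
have := ler_normD (expR x - 1 - x) (expR x * (cos y - 1)).
have := ler_normD (expR x * (sin y - y)) ((expR x - 1) * y).
lra.
Qed.

(* (1 - w) e^w = 1 + O(|w|^2): this is what makes e^(sum of gamma_n) a
   substitute for the inverse of the product of the 1 - gamma_n. *)
Lemma normc_cexp_mul1B (R : realType) (w : R[i]) (G : R) : norm w <= G ->
  norm (cexp w * (1 - w) - 1) <= (4 * expR G * (1 + G) + 1) * norm w ^+ 2.
Proof.
move=> wG.
have -> : cexp w * (1 - w) - 1 = (cexp w - 1 - w) * (1 - w) - w ^+ 2 by ring.
apply: le_trans (normcB _ _) _; rewrite normcX Normc.normcM mulrDl mul1r lerD2r.
rewrite mulrAC; apply: ler_pM; rewrite ?normc_ge0//; first exact: normc_cexp_sub1.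
by apply: le_trans (normcB _ _) _; rewrite Normc.normc1 lerD2l.
Qed.

Lemma normc_cexp_sub1_le (R : realType) (w : R[i]) (G : R) : norm w <= G ->
  norm (cexp w - 1) <= (4 * expR G * G + 1) * norm w.
Proof.
move=> wG.
have -> : cexp w - 1 = (cexp w - 1 - w) + w by ring.
apply: le_trans (le_normcD _ _) _; rewrite mulrDl mul1r lerD2r.
apply: le_trans (normc_cexp_sub1 wG) _.
rewrite -[X in _ <= X]mulrA; apply: ler_wpM2l; first by rewrite mulr_ge0// expR_ge0.
by rewrite expr2 ler_wpM2r// normc_ge0.
Qed.

(** * Uniform convergence on compact sets of R[i] *)

Lemma normc_gt0_real (R : rcfType) (e : R[i]) : 0 < e -> exists2 d : R, 0 < d & e = d%:C.
Proof.
by case: e => d f; rewrite ltcE /= => /andP[/eqP -> d0]; exists d.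
Qed.

Lemma uniform_cvg_normP (K : numFieldType) (A : set K) (F : nat -> K -> K) (g : K -> K) :
  {uniform A, F @ \oo --> g} <->
  (forall e : K, 0 < e -> exists N, forall n, (N <= n)%N ->
     forall z, A z -> `|F n z - g z| < e).
Proof.
split=> [Fg e e0|Fg].
  have entE : entourage [set xy : K * K | ball xy.1 e xy.2].
    by rewrite -entourage_ballE; exists e.
  have [] := Fg [set h | forall y, A y -> ball (g y) e (h y)].
    by apply/uniform_nbhs; exists [set xy : K * K | ball xy.1 e xy.2]; split.
  move=> N _ HN; exists N => n Nn z Az.
  by have := HN n Nn z Az; rewrite -ball_normE /ball_ /= distrC.
move=> P /uniform_nbhs [E [entE EP]].
move: entE; rewrite -entourage_ballE => -[e /= e0 Ee].
have [N HN] := Fg e e0.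
exists N => // n Nn; apply: EP => z Az; apply: Ee => /=.
by rewrite -ball_normE /ball_ /= distrC; exact: HN.
Qed.

(* [compact] and [continuous] have to refer to the topology that [R[i]] carries
   as a numFieldType, as in [cvg_unif_on_compacts]. *)
Definition complex_num (R : rcfType) : numFieldType := R[i].

Lemma normc_continuous (R : realType) :
  continuous (fun z : complex_num R => norm z : R).
Proof.
move=> z; apply/(@cvgrPdist_lt _ _ _ (nbhs z)) => e e0.
apply/nbhs_ballP; exists (e%:C : complex_num R) => /=; first by rewrite ltcR.
move=> w; rewrite -ball_normE /ball_ /= -[`|_|]/((norm (z - w))%:C) ltcR.
apply: le_lt_trans; rewrite ler_norml normcB_ge andbT lerNl opprB.
by rewrite distcC normcB_ge.
Qed.

(** The circle is closed and lies in the image of the square [-r, r]^2 under (x, y) -> x + iy;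
    continuity of this map carries compactness from the product topology to that of [R[i]]. *)
Lemma compact_circle (R : realType) (r : R) :
  compact ([set z | norm z = r] : set (complex_num R)).
Proof.
pose f (p : R * R) : complex_num R := p.1 +i* p.2.
have cf : continuous f.
  move=> [x y]; apply/cvgrPdist_lt => e; rewrite -[_ < e]/(0 < (e : R[i])) => /normc_gt0_real[d d0 ->].
  exists (ball x (d / 2), ball y (d / 2)) => /=.
    by split; apply: nbhsx_ballx; rewrite divr_gt0.
  move=> [x' y'] [/= ]; rewrite -!ball_normE /ball_ /= => h1 h2.
  rewrite -[`|_|]/((norm (f (x, y) - f (x', y')))%:C) ltcR.
  by apply: le_lt_trans (normc_le_ReIm _) _; rewrite /=; lra.
apply: (@subclosed_compact _ _ (f @` (`[- r, r]%classic `*` `[- r, r]%classic))).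
- have -> : [set z | norm z = r] = (fun z : complex_num R => norm z) @^-1` [set r] by [].
  by apply: closed_comp; [move=> z _; exact: normc_continuous|exact: closed_eq].
- apply: continuous_compact; first by apply: continuous_subspaceT => z; exact: cf.
  by apply: compact_setX; exact: segment_compact.
move=> z /= zr; exists (complex.Re z, complex.Im z); last by case: z {zr}.
by split; rewrite /= in_itv /= -ler_norml -zr; [exact: Re_le_normc|exact: Im_le_normc].
Qed.

Lemma compact_open_disc (R : realType) (A : set R[i]) :
  compact (A : set (complex_num R)) -> (forall z, A z -> norm z < 1) ->
  exists r : R, [/\ 0 < r, r < 1 & forall z, A z -> norm z <= r].
Proof.
move=> cA A1; have [/set0P A0|] := pselect (A != set0); last first.
  move=> /negP; rewrite negbK => /eqP ->; exists (1 / 2); split; [lra|lra|by []].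
have [c cA' cmax] := @compact_EVT_max (complex_num R) R (fun z => norm z) A A0 cA
  (continuous_subspaceT (@normc_continuous R)).
have c1 : norm c < 1 by apply: A1; rewrite inE in cA'.
(* The midpoint between the maximal modulus and 1 is positive even when A = {0}. *)
exists ((1 + norm c) / 2); have := normc_ge0 c; split; [lra|lra|].
move=> z Az; have := cmax z; rewrite inE => /(_ Az); lra.
Qed.

Lemma cvg_unif_on_compactsP (R : realType) (D : set R[i]) (F : nat -> R[i] -> R[i])
    (g : R[i] -> R[i]) :
  cvg_unif_on_compacts D F g <->
  (forall A : set R[i], compact (A : set (complex_num R)) -> A `<=` D ->
   forall e : R, 0 < e -> exists N, forall n, (N <= n)%N ->
     forall z, A z -> norm (F n z - g z) <= e).
Proof.
split=> H A cA AD.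
  move=> e e0; have /uniform_cvg_normP/(_ e%:C) := H A cA AD.
  rewrite -[0 < _]/(0 < e%:C :> R[i]) ltcR => /(_ e0)[N HN].
  exists N => n Nn z Az; rewrite ltW// -ltcR; exact: HN.
apply/uniform_cvg_normP => e; rewrite -[_ < e]/(0 < (e : R[i])) => /normc_gt0_real[d d0 ->].
have [N HN] := H A cA AD (d / 2) (divr_gt0 d0 (ltr0n _ 2)).
exists N => n Nn z Az; rewrite -[`|_|]/((norm (F n z - g z))%:C) ltcR.
by apply: le_lt_trans (HN n Nn z Az) _; lra.
Qed.

(** No limit function is mentioned, so products and exponentials can be treated before any limit is
    known. *)
Definition uniformly_cauchy (R : realType) (P : set R[i]) (u : nat -> R[i] -> R[i]) :=
  forall e : R, 0 < e -> exists N, forall m n, (N <= m)%N -> (m <= n)%N ->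
    forall z, P z -> norm (u n z - u m z) <= e.

Definition uniformly_bounded (R : realType) (P : set R[i]) (u : nat -> R[i] -> R[i]) :=
  exists2 B : R, 0 <= B & forall n z, P z -> norm (u n z) <= B.

(** A pointwise limit taken by coordinates. It does not depend on a disc, so a single limit function
    serves all compact subsets. *)
Definition complex_limn (R : realType) (u : nat -> R[i]) : R[i] :=
  limn (fun n => complex.Re (u n)) +i* limn (fun n => complex.Im (u n)).

Lemma cauchy_cvgn (R : realType) (u : nat -> R) :
  (forall e, 0 < e -> exists N, forall m n, (N <= m)%N -> (m <= n)%N ->
     `|u n - u m| <= e) ->
  cvgn u.
Proof.
move=> H; apply: cauchy_cvg; apply/cauchy_ballP => e e0.
have [N HN] := H (e / 2) (divr_gt0 e0 (ltr0n _ 2)).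
have H2 m n : (N <= m)%N -> (N <= n)%N -> `|u m - u n| < e.
  move=> Nm Nn; apply: (@le_lt_trans _ _ (e / 2)); last by lra.
  case: (leqP m n) => mn; first by rewrite distrC; exact: HN.
  by apply: HN => //; exact: ltnW.
exists (u @` [set x | (N <= x)%N], u @` [set x | (N <= x)%N]) => /=.
  by split; exists N => // n Nn; exists n.
by move=> [_ _] /= [[m Nm <-] [n Nn <-]]; rewrite -ball_normE /ball_ /=; exact: H2.
Qed.

Lemma uniformly_cauchy_limn (R : realType) (P : set R[i]) (u : nat -> R[i] -> R[i]) :
  uniformly_cauchy P u ->
  forall e : R, 0 < e -> exists N, forall n, (N <= n)%N ->
     forall z, P z -> norm (u n z - complex_limn (u ^~ z)) <= e.
Proof.
move=> cu e e0.
have [N HN] := cu (e / 2) (divr_gt0 e0 (ltr0n _ 2)).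
exists N => n Nn z Pz.
(* Here [f] stands for the real or the imaginary part; only its additivity and |f x| <= |x|
   matter. *)
have part (f : R[i] -> R) : (forall x y, f (x - y) = f x - f y) ->
    (forall x, `|f x| <= norm x) ->
    `|f (u n z) - limn (fun k => f (u k z))| <= e / 2.
  move=> fB fle.
  have cf : cvgn (fun k => f (u k z)).
    apply: cauchy_cvgn => d d0; have [M HM] := cu d d0; exists M => i j Mi ij.
    by apply: le_trans (HM i j Mi ij z Pz); rewrite -fB; exact: fle.
  have h : (fun m => `|f (u n z) - f (u m z)|) @ \oo -->
      `|f (u n z) - limn (fun k => f (u k z))|.
    by apply: cvg_norm; apply: cvgB; [exact: cvg_cst|exact: cf].
  apply: (cvgr_to_le h).
  exists n => // m nm; rewrite /= distrC -fB; apply: le_trans (fle _) _.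
  exact: HN.
apply: le_trans (normc_le_ReIm _) _.
have h1 := part (@complex.Re R) (@raddfB _ _ (@complex.Re R : Rcomplex R -> R)) (@Re_le_normc R).
have h2 := part (@complex.Im R) (@raddfB _ _ (@complex.Im R : Rcomplex R -> R)) (@Im_le_normc R).
have -> : complex.Re (u n z - complex_limn (u ^~ z)) =
    complex.Re (u n z) - limn (fun k => complex.Re (u k z)).
  exact: (@raddfB _ _ (@complex.Re R : Rcomplex R -> R)).
have -> : complex.Im (u n z - complex_limn (u ^~ z)) =
    complex.Im (u n z) - limn (fun k => complex.Im (u k z)).
  exact: (@raddfB _ _ (@complex.Im R : Rcomplex R -> R)).
lra.
Qed.

Lemma uniformly_cauchyM (R : realType) (P : set R[i]) (u v : nat -> R[i] -> R[i]) :
  uniformly_cauchy P u -> uniformly_cauchy P v ->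
  uniformly_bounded P u -> uniformly_bounded P v ->
  uniformly_cauchy P (fun n z => u n z * v n z).
Proof.
move=> cu cv [A A0 uA] [B B0 vB] e e0.
have AB : 0 < A + B + 1 by lra.
have d0 : 0 < e / (A + B + 1) by rewrite divr_gt0.
have [N1 H1] := cu _ d0; have [N2 H2] := cv _ d0.
exists (maxn N1 N2) => m n; rewrite geq_max => /andP[m1 m2] mn z Pz.
have -> : u n z * v n z - u m z * v m z =
  (u n z - u m z) * v n z + u m z * (v n z - v m z) by ring.
apply: le_trans (le_normcD _ _) _; rewrite !Normc.normcM.
have h1 : norm (u n z - u m z) * norm (v n z) <= e / (A + B + 1) * B.
  by rewrite ler_pM ?normc_ge0 ?H1 ?vB.
have h2 : norm (u m z) * norm (v n z - v m z) <= A * (e / (A + B + 1)).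
  by rewrite ler_pM ?normc_ge0 ?H2 ?uA.
apply: le_trans (lerD h1 h2) _; rewrite mulrC -mulrDl.
rewrite mulrA ler_pdivrMr// mulrC ler_wpM2l ?ltW//; lra.
Qed.

Lemma uniformly_cauchyB (R : realType) (P : set R[i]) (u v : nat -> R[i] -> R[i]) :
  uniformly_cauchy P u -> uniformly_cauchy P v ->
  uniformly_cauchy P (fun n z => u n z - v n z).
Proof.
move=> cu cv e e0; have d0 : 0 < e / 2 by rewrite divr_gt0.
have [N1 H1] := cu _ d0; have [N2 H2] := cv _ d0.
exists (maxn N1 N2) => m n; rewrite geq_max => /andP[m1 m2] mn z Pz.
have -> : u n z - v n z - (u m z - v m z) = (u n z - u m z) - (v n z - v m z) by ring.
apply: le_trans (normcB _ _) _.
have := H1 m n m1 mn z Pz; have := H2 m n m2 mn z Pz; lra.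
Qed.

Lemma uniformly_boundedM (R : realType) (P : set R[i]) (u v : nat -> R[i] -> R[i]) :
  uniformly_bounded P u -> uniformly_bounded P v ->
  uniformly_bounded P (fun n z => u n z * v n z).
Proof.
move=> [A A0 uA] [B B0 vB]; exists (A * B); first exact: mulr_ge0.
by move=> n z Pz; rewrite Normc.normcM ler_pM ?normc_ge0 ?uA ?vB.
Qed.

Lemma uniformly_boundedB (R : realType) (P : set R[i]) (u v : nat -> R[i] -> R[i]) :
  uniformly_bounded P u -> uniformly_bounded P v ->
  uniformly_bounded P (fun n z => u n z - v n z).
Proof.
move=> [A A0 uA] [B B0 vB]; exists (A + B); first exact: addr_ge0.
move=> n z Pz; apply: le_trans (normcB _ _) _.
by rewrite lerD ?uA ?vB.
Qed.

Lemma cexp_uniformly_bounded (R : realType) (P : set R[i]) (u : nat -> R[i] -> R[i]) :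
  uniformly_bounded P u -> uniformly_bounded P (fun n z => cexp (u n z)).
Proof.
move=> [B B0 uB]; exists (expR B); first exact: expR_ge0.
move=> n z Pz; rewrite normc_cexp ler_expR.
by apply: le_trans (ler_norm _) (le_trans (Re_le_normc _) _); exact: uB.
Qed.

Lemma cexp_uniformly_cauchy (R : realType) (P : set R[i]) (u : nat -> R[i] -> R[i]) :
  uniformly_bounded P u -> uniformly_cauchy P u ->
  uniformly_cauchy P (fun n z => cexp (u n z)).
Proof.
move=> bu cu; have [B B0 uB] := cexp_uniformly_bounded bu.
move=> e e0; have K0 : 0 < B * (4 * expR 1 * 1 + 1) + 1.
  by rewrite ltr_wpDl// mulr_ge0// addr_ge0// !mulr_ge0// expR_ge0.
(* Capping the increment by 1 allows [normc_cexp_sub1_le] with G = 1. *)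
have d0 : 0 < Num.min 1 (e / (B * (4 * expR 1 * 1 + 1) + 1)).
  by rewrite lt_min ltr01 divr_gt0.
have [N HN] := cu _ d0; exists N => m n Nm mn z Pz.
have := HN m n Nm mn z Pz; rewrite le_min => /andP[h1 h2].
have -> : cexp (u n z) - cexp (u m z) = cexp (u m z) * (cexp (u n z - u m z) - 1).
  by rewrite mulrBr -cexpD mulr1 [u m z + _]addrC subrK.
rewrite Normc.normcM.
apply: le_trans (_ : B * ((4 * expR 1 * 1 + 1) * norm (u n z - u m z)) <= _).
  by rewrite ler_pM ?normc_ge0 ?uB ?normc_cexp_sub1_le.
move: h2; rewrite ler_pdivlMr//; have := normc_ge0 (u n z - u m z); lra.
Qed.

(** * The recursion for z^n P_n(z + 1/z) *)

(* The polynomial z^n P_n(z + z^-1), where P_n is the monic multiple of p_n. *)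
Fixpoint scaled_monic (R : realType) (a b : nat -> R) (n : nat) : {poly R} :=
  if n is m.+1 then
    ('X^2 + 1 - b m *: 'X) * scaled_monic a b m
    - if m is l.+1 then (a l ^+ 2) *: ('X^2 * scaled_monic a b l) else 0
  else 1.

(** In characteristic 0 the integers 1, 2, ... are distinct and non-zero, which provides more roots
    of p - q than its degree allows. This extends identities involving 1/z to z = 0. *)
Lemma poly_eq_off0 (K : numFieldType) (p q : {poly K}) :
  (forall z, z != 0 -> p.[z] = q.[z]) -> p = q.
Proof.
move=> pq; apply/eqP; rewrite -subr_eq0; apply/eqP.
apply: (@roots_geq_poly_eq0 _ _ [seq k.+1%:R | k <- iota 0 (size (p - q))]).
- apply/allP => _ /mapP[k _ ->]; rewrite rootE hornerD hornerN pq; first by rewrite subrr.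
  by rewrite pnatr_eq0.
- rewrite map_inj_uniq ?iota_uniq// => i j /eqP.
  by rewrite eqr_nat => /eqP[].
by rewrite size_map size_iota.
Qed.

Lemma horner_scaled_monicS (R : realType) (a b : nat -> R) (z : R[i]) (n : nat) :
  let F k := (map_poly (real_complex R) (scaled_monic a b k)).[z] in
  F n.+1 = (z ^+ 2 + 1 - (b n)%:C * z) * F n
     - (if n is m.+1 then (a m)%:C ^+ 2 * (z ^+ 2 * F m) else 0).
Proof.
move=> F; rewrite {1}/F /= rmorphB rmorphM rmorphB rmorphD /= linearZ /= map_polyX map_polyXn.
rewrite rmorph1 hornerD hornerM hornerN hornerD hornerN hornerD hornerXn hornerC.
rewrite hornerZ hornerX; congr (_ - _).
case: n => [|l]; rewrite ?rmorph0 ?horner0// linearZ /= hornerZ rmorphXn /=.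
by rewrite rmorphM /= map_polyXn hornerM hornerXn.
Qed.

Lemma scaled_polyE_monic (R : realType) (a b : nat -> R) (n : nat) :
  (forall n, 0 < a n) ->
  scaled_poly a b n =
    map_poly (real_complex R) ((\prod_(k < n) a k)^-1 *: scaled_monic a b n).
Proof.
move=> a0; apply: poly_eq_off0 => z z0; rewrite scaled_polyE//.
have aC k : (a k)%:C != 0 :> R[i] by rewrite fmorph_eq0 gt_eqF.
pose p k := (map_poly (real_complex R) (orthonormal_poly a b k)).[z + z^-1].
pose F k := (map_poly (real_complex R) (scaled_monic a b k)).[z].
pose A k := (\prod_(i < k) a i)%:C : R[i].
have A0 k : A k != 0 by rewrite fmorph_eq0; apply/prodf_neq0 => i _; rewrite gt_eqF.
have AS k : A k.+1 = A k * (a k)%:C by rewrite /A big_ord_recr rmorphM.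
have p0 : p 0%N = 1 by rewrite /p /= rmorph1 hornerC.
have F0 : F 0%N = 1 by rewrite /F /= rmorph1 hornerC.
have pS k : p k.+1 = ((a k)%:C)^-1 * ((z + z^-1 - (b k)%:C) * p k
     - (if k is l.+1 then (a l)%:C * p l else 0)).
  rewrite {1}/p /= linearZ /= hornerZ fmorphV; congr (_ * _).
  rewrite rmorphB rmorphM rmorphB /= map_polyX map_polyC /= !hornerE; congr (_ - _).
  by case: k => [|l]; rewrite ?rmorph0 ?horner0// linearZ /= hornerZ.
have FS k : F k.+1 = (z ^+ 2 + 1 - (b k)%:C * z) * F k
     - (if k is l.+1 then (a l)%:C ^+ 2 * (z ^+ 2 * F l) else 0).
  exact: horner_scaled_monicS.
rewrite linearZ /= hornerZ fmorphV /= -/(F n) -/(A n) -/(p n).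
suff H : A n * (z ^+ n * p n) = F n by rewrite -H mulKf.
(* Two consecutive indices are carried along because the recursion has order two. *)
have [] : A n * (z ^+ n * p n) = F n /\ A n.+1 * (z ^+ n.+1 * p n.+1) = F n.+1; last by [].
elim: n => [|n [IH1 IH2]].
  rewrite pS FS AS p0 F0 /A big_ord0 rmorph1; split; first by rewrite expr0 !mulr1.
  by field; rewrite z0 aC.
split=> //; rewrite pS FS -IH1 -IH2 !AS !exprS.
by field; rewrite z0 aC.
Qed.

Lemma horner_scaled_monicSS (R : realType) (a b : nat -> R) (z : R[i]) (n : nat) :
  let F k := (map_poly (real_complex R) (scaled_monic a b k)).[z] in
  F n.+2 = (1 + z ^+ 2 - (b n.+1)%:C * z) * F n.+1 - (a n)%:C ^+ 2 * z ^+ 2 * F n.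
Proof. by move=> F; rewrite /F horner_scaled_monicS; ring. Qed.

Lemma horner_scaled_monic0 (R : realType) (a b : nat -> R) (z : R[i]) :
  (map_poly (real_complex R) (scaled_monic a b 0)).[z] = 1.
Proof. by rewrite /= rmorph1 hornerC. Qed.

Lemma horner_scaled_monic1 (R : realType) (a b : nat -> R) (z : R[i]) :
  (map_poly (real_complex R) (scaled_monic a b 1)).[z] = 1 + z ^+ 2 - (b 0%N)%:C * z.
Proof. by rewrite horner_scaled_monicS horner_scaled_monic0; ring. Qed.

(** * The perturbed recursion in the disc *)

(* For F = scaled_monic, c n is b (n + 1) and d n is a n ^ 2 - 1. *)
Definition jacobi_rec (R : realType) (c d : nat -> R) (F : nat -> R[i] -> R[i]) :=
  forall n z, F n.+2 z = (1 + z ^+ 2 - (c n)%:C * z) * F n.+1 z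
                         - (1 + (d n)%:C) * z ^+ 2 * F n z.

(** Substituting F_{n+1} = (Q_n - z^2 D_n) / (1 - z^2) and F_n = (Q_n - D_n) / (1 - z^2) into the
    perturbation -(c_n z F_{n+1} + d_n z^2 F_n) gives -gamma_n Q_n + delta_n D_n, with [jdelta] the
    second coefficient. *)
Definition jgamma (R : realType) (c d : nat -> R) (n : nat) (z : R[i]) : R[i] :=
  ((c n)%:C * z + (d n)%:C * z ^+ 2) / (1 - z ^+ 2).

Definition jdelta (R : realType) (c d : nat -> R) (n : nat) (z : R[i]) : R[i] :=
  ((c n)%:C * z ^+ 3 + (d n)%:C * z ^+ 2) / (1 - z ^+ 2).

Definition jGamma (R : realType) (c d : nat -> R) (n : nat) (z : R[i]) : R[i] :=
  \sum_(k < n) jgamma c d k z.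

Definition closed_disc (R : realType) (r : R) : set R[i] := [set z | norm z <= r].

Lemma cvgn_cauchy (R : realType) (u : nat -> R) : cvgn u ->
  forall e, 0 < e -> exists N, forall m n, (N <= m)%N -> (m <= n)%N -> `|u n - u m| <= e.
Proof.
move=> cu e e0.
have [N _ HN] : \forall n \near \oo, `|limn u - u n| < e / 2.
  by move/cvgrPdist_lt: cu; apply; rewrite divr_gt0.
exists N => m n Nm mn.
have h1 := HN m Nm; have h2 := HN n (leq_trans Nm mn).
have -> : u n - u m = (limn u - u m) - (limn u - u n) by ring.
by apply: le_trans (ler_normB _ _) _; move: h1 h2 => /=; lra.
Qed.

Lemma cvgn_bounded (R : realType) (u : nat -> R) : cvgn u ->
  exists2 B, 0 <= B & forall n, `|u n| <= B.
Proof.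
move=> /cvg_seq_bounded/pinfty_ex_gt0[B B0 /= HB]; exists B; first exact: ltW.
by move=> n; exact: HB.
Qed.

Lemma sub1_sqr_lower (R : realType) (r : R) (z : R[i]) :
  0 <= r -> r < 1 -> norm z <= r -> 1 - r ^+ 2 <= norm (1 - z ^+ 2).
Proof.
move=> r0 r1 zr; apply: le_trans (normcB_ge _ _); rewrite Normc.normc1 normcX lerD2l lerN2.
by rewrite ler_sqr ?nnegrE ?normc_ge0.
Qed.

Lemma inv_sub1_sqr (R : realType) (r : R) (z : R[i]) :
  0 <= r -> r < 1 -> norm z <= r ->
  1 - z ^+ 2 != 0 /\ norm (1 - z ^+ 2)^-1 <= (1 - r ^+ 2)^-1.
Proof.
move=> r0 r1 zr; have h := sub1_sqr_lower r0 r1 zr.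
have p0 : 0 < 1 - r ^+ 2 by rewrite subr_gt0 expr_lt1.
have n0 : 0 < norm (1 - z ^+ 2) by exact: lt_le_trans h.
split; first by rewrite -normc_gt0.
by rewrite Normc.normcV lef_pV2.
Qed.

Lemma normc_comb (R : realType) (r x y : R) (z w1 w2 : R[i]) :
  0 <= r -> r < 1 -> norm z <= r -> norm w1 <= 1 -> norm w2 <= 1 ->
  norm ((x%:C * w1 + y%:C * w2) / (1 - z ^+ 2)) <= (1 - r ^+ 2)^-1 * (`|x| + `|y|).
Proof.
move=> r0 r1 zr h1 h2; have [_ h] := inv_sub1_sqr r0 r1 zr.
rewrite Normc.normcM mulrC ler_pM ?normc_ge0//.
apply: le_trans (le_normcD _ _) _; rewrite !Normc.normcM !normc_real.
by rewrite lerD// -[X in _ <= X]mulr1 ler_wpM2l.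
Qed.

Lemma normcX_le1 (R : rcfType) (r : R) (z : R[i]) n :
  0 <= r -> r < 1 -> norm z <= r -> norm (z ^+ n) <= 1.
Proof.
move=> r0 r1 zr; rewrite normcX exprn_ile1 ?normc_ge0//.
by rewrite (le_trans zr)// ltW.
Qed.

Lemma jgamma_le (R : realType) (c d : nat -> R) (r : R) n (z : R[i]) :
  0 <= r -> r < 1 -> norm z <= r ->
  norm (jgamma c d n z) <= (1 - r ^+ 2)^-1 * (`|c n| + `|d n|).
Proof.
move=> r0 r1 zr; apply: normc_comb => //; last exact: (normcX_le1 _ r0).
by rewrite -[z]expr1; exact: (normcX_le1 _ r0).
Qed.

Lemma jdelta_le (R : realType) (c d : nat -> R) (r : R) n (z : R[i]) :
  0 <= r -> r < 1 -> norm z <= r ->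
  norm (jdelta c d n z) <= (1 - r ^+ 2)^-1 * (`|c n| + `|d n|).
Proof. by move=> r0 r1 zr; apply: normc_comb => //; exact: (normcX_le1 _ r0). Qed.

(** The dependence on z factors out, so conditional convergence of two numerical series already
    gives uniform control of [jGamma] on a disc. *)
Lemma jGammaE (R : realType) (c d : nat -> R) n (z : R[i]) :
  jGamma c d n z = ((series c n)%:C * z + (series d n)%:C * z ^+ 2) / (1 - z ^+ 2).
Proof.
rewrite /jGamma /jgamma -mulr_suml; congr (_ / _).
by rewrite big_split /= -!mulr_suml -!rmorph_sum /= !seriesEord.
Qed.

Lemma jGamma_bounded (R : realType) (c d : nat -> R) (r : R) :
  0 <= r -> r < 1 -> cvgn (series c) -> cvgn (series d) ->
  uniformly_bounded (closed_disc r) (jGamma c d).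
Proof.
move=> r0 r1 /cvgn_bounded[B1 B10 h1] /cvgn_bounded[B2 B20 h2].
have p0 : 0 <= (1 - r ^+ 2)^-1 by rewrite invr_ge0 subr_ge0 ltW// expr_lt1.
exists ((1 - r ^+ 2)^-1 * (B1 + B2)); first by rewrite mulr_ge0// addr_ge0.
move=> n z zr; rewrite jGammaE.
apply: le_trans (normc_comb _ _ r0 r1 zr _ (normcX_le1 2 r0 r1 zr)) _.
  by rewrite -[z]expr1; exact: (normcX_le1 _ r0).
by rewrite ler_wpM2l// lerD.
Qed.

Lemma jGamma_cauchy (R : realType) (c d : nat -> R) (r : R) :
  0 <= r -> r < 1 -> cvgn (series c) -> cvgn (series d) ->
  uniformly_cauchy (closed_disc r) (jGamma c d).
Proof.
move=> r0 r1 /cvgn_cauchy h1 /cvgn_cauchy h2 e e0.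
have p0 : 0 < 1 - r ^+ 2 by rewrite subr_gt0 expr_lt1.
have d0 : 0 < (1 - r ^+ 2) * (e / 2) by rewrite mulr_gt0// divr_gt0.
have [N1 H1] := h1 _ d0; have [N2 H2] := h2 _ d0.
exists (maxn N1 N2) => m n; rewrite geq_max => /andP[m1 m2] mn z zr.
rewrite !jGammaE -mulrBl.
have -> : (series c n)%:C * z + (series d n)%:C * z ^+ 2 -
  ((series c m)%:C * z + (series d m)%:C * z ^+ 2) =
  (series c n - series c m)%:C * z + (series d n - series d m)%:C * z ^+ 2.
  by rewrite !rmorphB /=; ring.
apply: le_trans (normc_comb _ _ r0 r1 zr _ (normcX_le1 2 r0 r1 zr)) _.
  by rewrite -[z]expr1; exact: (normcX_le1 _ r0).
rewrite ler_pdivrMl//; have := H1 m n m1 mn; have := H2 m n m2 mn; lra.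
Qed.

(** The unperturbed recursion has the solutions 1 and z^(2n); [jD] annihilates the first and [jQ]
    the second. *)
Definition jD (R : realType) (F : nat -> R[i] -> R[i]) n z := F n.+1 z - F n z.

Definition jQ (R : realType) (F : nat -> R[i] -> R[i]) n z := F n.+1 z - z ^+ 2 * F n z.

Definition jQt (R : realType) (c d : nat -> R) (F : nat -> R[i] -> R[i]) n z :=
  cexp (jGamma c d n z) * jQ F n z.

Lemma jQS (R : realType) (c d : nat -> R) (F : nat -> R[i] -> R[i]) n z :
  jacobi_rec c d F -> 1 - z ^+ 2 != 0 ->
  jQ F n.+1 z = (1 - jgamma c d n z) * jQ F n z + jdelta c d n z * jD F n z.
Proof.
move=> rF z1; rewrite /jQ /jD /jgamma /jdelta rF.
by field.
Qed.

Lemma jDS (R : realType) (c d : nat -> R) (F : nat -> R[i] -> R[i]) n z :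
  jacobi_rec c d F -> 1 - z ^+ 2 != 0 ->
  jD F n.+1 z = (z ^+ 2 + jdelta c d n z) * jD F n z - jgamma c d n z * jQ F n z.
Proof.
move=> rF z1; rewrite /jQ /jD /jgamma /jdelta rF.
by field.
Qed.

(** Multiplication by e^Gamma turns the first-order term gamma Q into one of size k^2; this is where
    k (k x + y) in place of k (x + y) comes from. Boundedness of Gamma keeps Q and its modification
    comparable, so the bound for D survives. *)
Lemma jQt_jD_estimates (R : realType) (c d : nat -> R) (F : nat -> R[i] -> R[i]) (r : R) :
  0 <= r -> r < 1 -> cvgn (series c) -> cvgn (series d) ->
  cvgn (series (fun n => (`|c n| + `|d n|) ^+ 2)) -> jacobi_rec c d F ->
  exists2 C : R, 0 <= C & forall n z, norm z <= r ->
    let k := `|c n| + `|d n| in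
    norm (jQt c d F n.+1 z - jQt c d F n z) <=
      C * k * (k * norm (jQt c d F n z) + norm (jD F n z)) /\
    norm (jD F n.+1 z) <=
      r ^+ 2 * norm (jD F n z) + C * k * (norm (jQt c d F n z) + norm (jD F n z)).
Proof.
move=> r0 r1 cc cd ck rF.
have k0 n : 0 <= `|c n| + `|d n| by rewrite addr_ge0.
have [M M0 kM] := sqr_summable_bounded k0 ck.
have [B B0 GB] := jGamma_bounded r0 r1 cc cd.
have p0 : 0 < 1 - r ^+ 2 by rewrite subr_gt0 expr_lt1.
set S := (1 - r ^+ 2)^-1; have S0 : 0 <= S by rewrite invr_ge0 ltW.
pose K := 4 * expR (S * M) * (1 + S * M) + 1.
have K0 : 0 <= K.
  by rewrite addr_ge0// mulr_ge0 ?addr_ge0 ?mulr_ge0// expR_ge0.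
have KS0 : 0 <= K * S ^+ 2 by rewrite mulr_ge0// exprn_ge0.
have eS0 : 0 <= expR B * S by rewrite mulr_ge0// expR_ge0.
(* The three summands come from the second-order remainder, from the terms carrying an exponential
   factor, and from delta D in the step of D. *)
exists (K * S ^+ 2 + expR B * S + S); first by rewrite !addr_ge0.
move=> n z zr k; have kn0 : 0 <= k := k0 n.
have [z1 _] := inv_sub1_sqr r0 r1 zr.
have hg := jgamma_le c d n r0 r1 zr; rewrite -/S -/k in hg.
have hd := jdelta_le c d n r0 r1 zr; rewrite -/S -/k in hd.
have hgM : norm (jgamma c d n z) <= S * M.
  by apply: le_trans hg _; rewrite ler_wpM2l//; exact: kM.
have eb m : norm (cexp (jGamma c d m z)) <= expR B.
  rewrite normc_cexp ler_expR.
  by apply: le_trans (ler_norm _) (le_trans (Re_le_normc _) _); exact: GB.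
have ebN m : norm (cexp (- jGamma c d m z)) <= expR B.
  rewrite normc_cexp ler_expR.
  by apply: le_trans (ler_norm _) (le_trans (Re_le_normc _) _); rewrite normcN; exact: GB.
set x := norm (jQt c d F n z); set y := norm (jD F n z).
have x0 : 0 <= x by exact: normc_ge0.
have y0 : 0 <= y by exact: normc_ge0.
have ky0 : 0 <= k * y by exact: mulr_ge0.
have kx0 : 0 <= k * x by exact: mulr_ge0.
have kkx0 : 0 <= k * (k * x) by exact: mulr_ge0.
have t1 := mulr_ge0 KS0 ky0. have t2 := mulr_ge0 KS0 kx0.
have t3 := mulr_ge0 eS0 kkx0. have t4 := mulr_ge0 eS0 ky0.
have t5 := mulr_ge0 S0 kkx0. have t6 := mulr_ge0 S0 ky0. have t7 := mulr_ge0 S0 kx0.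
split.
  have -> : jQt c d F n.+1 z - jQt c d F n z =
      (cexp (jgamma c d n z) * (1 - jgamma c d n z) - 1) * jQt c d F n z +
      cexp (jGamma c d n.+1 z) * (jdelta c d n z * jD F n z).
    rewrite /jQt (jQS n rF z1) /jGamma big_ord_recr /= cexpD; ring.
  apply: le_trans (le_normcD _ _) _.
  rewrite (Normc.normcM _ (jQt c d F n z)) (Normc.normcM (cexp (jGamma c d n.+1 z))).
  rewrite (Normc.normcM (jdelta c d n z)) -/x -/y.
  have h1 : norm (cexp (jgamma c d n z) * (1 - jgamma c d n z) - 1) <= K * (S * k) ^+ 2.
    apply: le_trans (normc_cexp_mul1B hgM) _; rewrite ler_wpM2l//.
    by rewrite ler_sqr ?nnegrE ?normc_ge0// mulr_ge0.
  have h2 := ler_wpM2r x0 h1.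
  have h3 : norm (cexp (jGamma c d n.+1 z)) * (norm (jdelta c d n z) * y) <=
      expR B * (S * k * y).
    rewrite ler_pM ?normc_ge0//; first by rewrite mulr_ge0// normc_ge0.
    by rewrite ler_wpM2r.
  rewrite exprMn in h2; clearbody S K k x y. lra.
rewrite (jDS n rF z1); apply: le_trans (normcB _ _) _.
have -> : jQ F n z = cexp (- jGamma c d n z) * jQt c d F n z.
  by rewrite /jQt mulrA cexpN mul1r.
rewrite (Normc.normcM _ (jD F n z)) (Normc.normcM (jgamma c d n z)).
rewrite (Normc.normcM _ (jQt c d F n z)) -/x -/y.
have h1 : norm (z ^+ 2 + jdelta c d n z) * y <= (r ^+ 2 + S * k) * y.
  rewrite ler_wpM2r//; apply: le_trans (le_normcD _ _) _; rewrite lerD// normcX.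
  by rewrite ler_sqr ?nnegrE ?normc_ge0.
have h2 : norm (jgamma c d n z) * (norm (cexp (- jGamma c d n z)) * x) <=
   (S * k) * (expR B * x).
  rewrite ler_pM ?normc_ge0//; first by rewrite mulr_ge0// normc_ge0.
  by rewrite ler_wpM2r.
clearbody S K k x y. lra.
Qed.

Lemma squeeze0 (R : realType) (u v : nat -> R) :
  (forall n, 0 <= u n) -> (forall n, u n <= v n) -> v @ \oo --> (0 : R) -> u @ \oo --> (0 : R).
Proof.
move=> u0 uv v0.
apply: (squeeze_cvgr _ (cvg_cst (0 : R)) v0).
by exists 0%N => // n _; rewrite /= u0 uv.
Qed.

Lemma uniformly_cauchy_sub (R : realType) (P : set R[i]) (u : nat -> R[i] -> R[i])
    (X : nat -> R) :
  cvgn X -> (forall n z, P z -> norm (u n.+1 z - u n z) <= X n.+1 - X n) ->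
  uniformly_cauchy P u.
Proof.
move=> cX uX e e0; have [N HN] := cvgn_cauchy cX e0.
exists N => m n Nm mn z Pz.
apply: le_trans (HN m n Nm mn); apply: le_trans (ler_norm _).
rewrite -(subnKC mn); elim: (n - m)%N => [|j IH].
  by rewrite addn0 !subrr Normc.normc0.
have -> : u (m + j.+1)%N z - u m z = (u (m + j).+1%N z - u (m + j)%N z) + (u (m + j)%N z - u m z).
  by rewrite addnS; ring.
apply: le_trans (le_normcD _ _) _; rewrite addnS.
have := uX (m + j)%N z Pz; lra.
Qed.

(** By induction both moduli lie below [majorant], which is free of z, and the increments of [jQt]
    lie below those of its convergent first component. *)
Lemma jQt_jD_cvg (R : realType) (c d : nat -> R)
    (F : nat -> R[i] -> R[i]) (r B : R) :
  0 <= r -> r < 1 -> cvgn (series c) -> cvgn (series d) ->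
  cvgn (series (fun n => (`|c n| + `|d n|) ^+ 2)) -> jacobi_rec c d F ->
  0 <= B ->
  (forall z, closed_disc r z -> norm (F 0%N z) <= B /\ norm (F 1%N z) <= B) ->
  [/\ uniformly_cauchy (closed_disc r) (jQt c d F),
      uniformly_bounded (closed_disc r) (jQt c d F),
      uniformly_cauchy (closed_disc r) (jD F) &
      uniformly_bounded (closed_disc r) (jD F)].
Proof.
move=> r0 r1 cc cd ck rF B0 FB; have [C C0 est] := jQt_jD_estimates r0 r1 cc cd ck rF.
pose k n := `|c n| + `|d n|; have k0 n : 0 <= k n by rewrite addr_ge0.
pose q := r ^+ 2; have q0 : 0 <= q by rewrite exprn_ge0.
have q1 : q < 1 by rewrite expr_lt1.
(* The common starting value 2 B bounds both |F_1 - z^2 F_0| and |F_1 - F_0|. *)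
have BB0 : 0 <= B + B by rewrite addr_ge0.
pose X n := (majorant q C (B + B) (B + B) k n).1.
pose Y n := (majorant q C (B + B) (B + B) k n).2.
have [cX Y0] : cvgn X /\ Y @ \oo --> (0 : R) by exact: majorant_cvg.
have maj n z : closed_disc r z -> norm (jQt c d F n z) <= X n /\ norm (jD F n z) <= Y n.
  move=> zr; elim: n => [|n [IHx IHy]].
    have [f0 f1] := FB z zr; split.
      rewrite /jQt /jGamma big_ord0 cexp0 mul1r /jQ.
      apply: le_trans (normcB _ _) _; rewrite lerD// Normc.normcM.
      by rewrite -[X in _ <= X]mul1r ler_pM ?normc_ge0// (normcX_le1 2 r0 r1).
    by apply: le_trans (normcB _ _) _; rewrite lerD.
  have [h1 h2] := est n z zr.
  have ck0 : 0 <= C * k n by rewrite mulr_ge0.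
  split.
    rewrite -(subrK (jQt c d F n z) (jQt c d F n.+1 z)).
    apply: le_trans (le_normcD _ _) _; rewrite /X /= addrC lerD//.
    by apply: le_trans h1 _; apply: ler_wpM2l => //; rewrite lerD// ler_wpM2l.
  apply: le_trans h2 _; rewrite /Y /= lerD//; first by rewrite ler_wpM2l.
  by apply: ler_wpM2l => //; rewrite lerD.
have [BX BX0 XB] := cvgn_bounded cX.
have [BY BY0 YB] : exists2 B, 0 <= B & forall n, `|Y n| <= B.
  by apply: cvgn_bounded; exact: (cvgP _ Y0).
split.
- apply: (uniformly_cauchy_sub cX) => n z zr.
  have [h1 h2] := maj n z zr; have [h3 _] := est n z zr.
  apply: le_trans h3 _; rewrite /X /= [X in _ <= X]addrAC subrr add0r.
  by apply: ler_wpM2l; [rewrite mulr_ge0|rewrite lerD// ler_wpM2l].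
- exists BX => // n z zr; have [h1 _] := maj n z zr.
  by apply: le_trans h1 (le_trans (ler_norm _) _).
- move=> e e0; have e2 : 0 < e / 2 by rewrite divr_gt0.
  have [N _ HN] : \forall n \near \oo, Y n < e / 2 by exact: (cvgr_lt 0 Y0).
  exists N => m n Nm mn z zr; apply: le_trans (normcB _ _) _.
  have [_ h1] := maj n z zr; have [_ h2] := maj m z zr.
  have := HN n (leq_trans Nm mn); have := HN m Nm => /=; lra.
- exists BY => // n z zr; have [_ h1] := maj n z zr.
  by apply: le_trans h1 (le_trans (ler_norm _) _).
Qed.

(** F_n is recovered as (e^(-Gamma_n) Qt_n - D_n) / (1 - z^2), where every ingredient is uniformly
    Cauchy and bounded on the disc. *)
Lemma jacobi_rec_cvg (R : realType) (c d : nat -> R)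
    (F : nat -> R[i] -> R[i]) (r B : R) :
  0 <= r -> r < 1 -> cvgn (series c) -> cvgn (series d) ->
  cvgn (series (fun n => (`|c n| + `|d n|) ^+ 2)) -> jacobi_rec c d F ->
  0 <= B ->
  (forall z, closed_disc r z -> norm (F 0%N z) <= B /\ norm (F 1%N z) <= B) ->
  uniformly_cauchy (closed_disc r) F /\ uniformly_bounded (closed_disc r) F.
Proof.
move=> r0 r1 cc cd ck rF B0 FB.
have [cQ bQ cD bD] := jQt_jD_cvg r0 r1 cc cd ck rF B0 FB.
have bG := jGamma_bounded r0 r1 cc cd.
have cG := jGamma_cauchy r0 r1 cc cd.
have bGN : uniformly_bounded (closed_disc r) (fun n z => - jGamma c d n z).
  by case: bG => BG BG0 h; exists BG => // n z zr; rewrite normcN; exact: h.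
have cGN : uniformly_cauchy (closed_disc r) (fun n z => - jGamma c d n z).
  move=> e e0; have [N HN] := cG e e0; exists N => m n Nm mn z zr.
  by rewrite -opprD normcN; exact: HN.
have be := cexp_uniformly_bounded bGN.
have ce := cexp_uniformly_cauchy bGN cGN.
have cI : uniformly_cauchy (closed_disc r) (fun _ z => (1 - z ^+ 2)^-1).
  by move=> e e0; exists 0%N => m n _ _ z _; rewrite subrr Normc.normc0 ltW.
have bI : uniformly_bounded (closed_disc r) (fun _ z => (1 - z ^+ 2)^-1).
  exists (1 - r ^+ 2)^-1; first by rewrite invr_ge0 subr_ge0 ltW// expr_lt1.
  by move=> n z zr; have [] := inv_sub1_sqr r0 r1 zr.
have cE := uniformly_cauchyM (uniformly_cauchyB (uniformly_cauchyM cQ ce bQ be) cD) cI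
  (uniformly_boundedB (uniformly_boundedM bQ be) bD) bI.
have bE := uniformly_boundedM (uniformly_boundedB (uniformly_boundedM bQ be) bD) bI.
have FE n z : closed_disc r z ->
   (jQt c d F n z * cexp (- jGamma c d n z) - jD F n z) / (1 - z ^+ 2) = F n z.
  move=> zr; have [z1 _] := inv_sub1_sqr r0 r1 zr.
  rewrite /jQt mulrAC [cexp _ * cexp _]mulrC cexpN mul1r /jQ /jD.
  by field.
split.
  move=> e e0; have [N HN] := cE e e0; exists N => m n Nm mn z zr.
  by rewrite -!FE//; exact: HN.
by case: bE => BE BE0 h; exists BE => // n z zr; rewrite -FE//; exact: h.
Qed.

(* If the limit vanishes, the growing component tends to 0, so by the dichotomy
   it is dominated by the decaying one. *)
Lemma jacobi_rec_decay (R : realType) (c d : nat -> R) (F : nat -> R[i] -> R[i])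
    (z : R[i]) (s : R) :
  norm z < 1 -> norm z ^+ 2 < s ->
  cvgn (series c) -> cvgn (series d) ->
  cvgn (series (fun n => (`|c n| + `|d n|) ^+ 2)) -> jacobi_rec c d F ->
  (fun n => norm (F n z)) @ \oo --> (0 : R) ->
  exists N, exists2 K, 0 <= K & forall j, norm (F (N + j)%N z) <= K * s ^+ j.
Proof.
move=> z1 zs cc cd ck rF F0; have z0 := normc_ge0 z.
(* The estimates are taken on the disc of radius |z| itself, so that the damping factor is exactly
   |z|^2. *)
have [C C0 est] := jQt_jD_estimates z0 z1 cc cd ck rF.
have [B B0 GB] := jGamma_bounded z0 z1 cc cd.
have zz : closed_disc (norm z) z by exact: lexx.
have k0 n : 0 <= `|c n| + `|d n| by rewrite addr_ge0.
have [nz _] := inv_sub1_sqr z0 z1 (lexx _).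
have eb n : norm (cexp (jGamma c d n z)) <= expR B.
  rewrite normc_cexp ler_expR.
  by apply: le_trans (ler_norm _) (le_trans (Re_le_normc _) _); exact: GB.
have ebN n : norm (cexp (- jGamma c d n z)) <= expR B.
  rewrite normc_cexp ler_expR.
  by apply: le_trans (ler_norm _) (le_trans (Re_le_normc _) _); rewrite normcN; exact: GB.
have Qto0 : (fun n => norm (jQt c d F n z)) @ \oo --> (0 : R).
  have h : (fun n => expR B * (norm (F n.+1 z) + norm (F n z))) @ \oo --> (0 : R).
    have -> : (0 : R) = expR B * (0 + 0) by rewrite addr0 mulr0.
    apply: cvgM; first exact: cvg_cst.
    by apply: cvgD => //; rewrite (cvg_shiftS (fun n => norm (F n z))).
  apply: (squeeze0 _ _ h) => n; first exact: normc_ge0.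
  rewrite /jQt Normc.normcM ler_pM ?normc_ge0//.
  apply: le_trans (normcB _ _) _; rewrite lerD// Normc.normcM.
  by rewrite -[X in _ <= X]mul1r ler_pM ?normc_ge0// (normcX_le1 2 z0 z1).
have [|n|n|n|n|N HN] := @decay_dichotomy R (norm z ^+ 2) C s (fun n => `|c n| + `|d n|)
  (fun n => norm (jQt c d F n z)) (fun n => norm (jD F n z))
  (exprn_ge0 _ z0) _ C0 zs k0 _ _ ck Qto0.
- by rewrite expr_lt1.
- exact: normc_ge0.
- exact: normc_ge0.
- have [h _] := est n z zz.
  have := normcB_ge (jQt c d F n z) (jQt c d F n.+1 z); rewrite distcC; move: h => /=; lra.
- by have [_ h] := est n z zz.
have s0 : 0 <= s by apply: le_trans (ltW zs); exact: exprn_ge0.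
(* From F = (e^(-Gamma) Qt - D) / (1 - z^2) with |Qt| <= |D| and |D_{N+j}| <= |D_N| s^j. *)
exists N; exists ((expR B + 1) * norm (1 - z ^+ 2)^-1 * norm (jD F N z)).
  by rewrite !mulr_ge0 ?normc_ge0// addr_ge0// expR_ge0.
move=> j; have Dj : norm (jD F (N + j)%N z) <= norm (jD F N z) * s ^+ j.
  elim: j => [|j IH]; first by rewrite addn0 mulr1.
  rewrite addnS exprS mulrCA; apply: le_trans (ler_wpM2l s0 IH).
  by have [] := HN (N + j)%N (leq_addr _ _).
have [xy _] := HN (N + j)%N (leq_addr _ _).
have -> : F (N + j)%N z = (cexp (- jGamma c d (N + j) z) * jQt c d F (N + j) z -
   jD F (N + j) z) * (1 - z ^+ 2)^-1.
  by rewrite /jQt mulrA cexpN mul1r /jQ /jD; field.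
rewrite (Normc.normcM _ (1 - z ^+ 2)^-1).
have -> : (expR B + 1) * norm (1 - z ^+ 2)^-1 * norm (jD F N z) * s ^+ j =
  ((expR B + 1) * (norm (jD F N z) * s ^+ j)) * norm (1 - z ^+ 2)^-1 by ring.
apply: ler_wpM2r; first exact: normc_ge0.
apply: le_trans (normcB _ _) _.
rewrite (Normc.normcM _ (jQt c d F (N + j) z)).
have h1 : norm (cexp (- jGamma c d (N + j) z)) * norm (jQt c d F (N + j) z) <=
    expR B * (norm (jD F N z) * s ^+ j).
  by rewrite ler_pM ?normc_ge0// (le_trans xy).
by lra.
Qed.

(** * From the conditions to convergence *)

Lemma series_le_cvg_scale (R : realType) (u v : nat -> R) (K : R) :
  0 <= K -> (forall n, 0 <= u n) -> (forall n, 0 <= v n) ->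
  (forall n, u n <= K * v n) -> cvgn (series v) -> cvgn (series u).
Proof.
move=> K0 u0 v0 uv cv; apply: (@bounded_series_cvg _ _ (K * limn (series v))) => // n.
apply: le_trans (ler_wpM2l K0 (series_ge0_le_lim v0 cv n)).
by rewrite !seriesEnat /= mulr_sumr; apply: ler_sum => i _.
Qed.

Lemma cvg_series_shift (R : realType) (u : nat -> R) :
  cvgn (series u) -> cvgn (series (fun n => u n.+1)).
Proof.
move=> cu; have -> : series (fun n => u n.+1) = (fun n => series u n.+1 - u 0%N).
  apply/funext => n; rewrite !seriesEnat /= big_nat_recl//.
  by rewrite [X in X - _]addrC addrK.
apply: is_cvgB; last exact: is_cvg_cst.
by apply: (cvgP (limn (series u))); rewrite (cvg_shiftS (series u)).
Qed.

Lemma ln_ge_sub_inv (R : realType) (x : R) : 0 < x -> 1 - x^-1 <= ln x.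
Proof.
move=> x0; have h : ln (1 + (x^-1 - 1)) <= x^-1 - 1.
  by apply: le_ln1Dx; rewrite ltrBDl subrr invr_gt0.
rewrite addrC subrK lnV ?posrE// in h; lra.
Qed.

Lemma ln_le_sub1 (R : realType) (x : R) : 0 < x -> ln x <= x - 1.
Proof.
move=> x0; have h : ln (1 + (x - 1)) <= x - 1.
  by apply: le_ln1Dx; rewrite ltrBDl subrr.
by rewrite addrC subrK in h.
Qed.

Lemma condA_sub1 (R : realType) (a b : nat -> R) : condA a b ->
  cvgn (series (fun n => (a n - 1) ^+ 2)).
Proof.
apply: (@series_le_cvg_scale _ _ _ 1) => // n.
- exact: sqr_ge0.
by rewrite mul1r !real_normK ?num_real// lerDl sqr_ge0.
Qed.

Lemma condA_b (R : realType) (a b : nat -> R) : condA a b ->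
  cvgn (series (fun n => b n ^+ 2)).
Proof.
apply: (@series_le_cvg_scale _ _ _ 1) => // n.
- exact: sqr_ge0.
by rewrite mul1r !real_normK ?num_real// lerDr sqr_ge0.
Qed.

Lemma sqr_summable_cvg0 (R : realType) (u : nat -> R) :
  cvgn (series (fun n => u n ^+ 2)) -> u @ \oo --> (0 : R).
Proof. by move=> h; apply: cvg_sqr0; exact: cvg_series_cvg_0. Qed.

Lemma condA_a_cvg (R : realType) (a b : nat -> R) : condA a b -> a @ \oo --> (1 : R).
Proof.
move=> /condA_sub1/sqr_summable_cvg0 h.
have -> : a = (fun n => (a n - 1) + 1) by apply/funext => n; rewrite subrK.
rewrite -[X in _ --> X]add0r; apply: cvgD => //; exact: cvg_cst.
Qed.

Lemma condA_kappa (R : realType) (a b : nat -> R) : condA a b ->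
  cvgn (series (fun n => (`|b n.+1| + `|a n ^+ 2 - 1|) ^+ 2)).
Proof.
move=> cA; have [M M0 aM] : exists2 B, 0 <= B & forall n, `|a n| <= B.
  by apply: cvgn_bounded; exact: (cvgP _ (condA_a_cvg cA)).
pose v n := b n.+1 ^+ 2 + (a n - 1) ^+ 2.
have v0 n : 0 <= v n by rewrite addr_ge0 ?sqr_ge0.
have M2 : 0 <= (M + 1) ^+ 2 by exact: sqr_ge0.
(* This uses (s + t)^2 <= 2 s^2 + 2 t^2 and a^2 - 1 = (a + 1) (a - 1) with |a| <= M. *)
apply: (@series_le_cvg_scale _ _ v (2 + 2 * (M + 1) ^+ 2)) => //.
- by rewrite addr_ge0// mulr_ge0.
- move=> n; have := sqr_ge0 (`|b n.+1| - `|a n ^+ 2 - 1|).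
  have e1 : `|b n.+1| ^+ 2 = b n.+1 ^+ 2 by rewrite real_normK ?num_real.
  have e2 : `|a n ^+ 2 - 1| ^+ 2 <= (M + 1) ^+ 2 * (a n - 1) ^+ 2.
    rewrite real_normK ?num_real//.
    have -> : (a n ^+ 2 - 1) ^+ 2 = (a n + 1) ^+ 2 * (a n - 1) ^+ 2 by ring.
    rewrite ler_wpM2r ?sqr_ge0// -[X in X <= _]real_normK ?num_real//.
    rewrite ler_sqr ?nnegrE ?addr_ge0//.
    by apply: le_trans (ler_normD _ _) _; rewrite normr1 lerD2r.
  have h1 : 0 <= (M + 1) ^+ 2 * b n.+1 ^+ 2 by rewrite mulr_ge0// sqr_ge0.
  have h2 : 0 <= (a n - 1) ^+ 2 by exact: sqr_ge0.
  rewrite /v; lra.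
have -> : series v = series (fun n => b n.+1 ^+ 2) \+ series (fun n => (a n - 1) ^+ 2).
  by apply/funext => n; rewrite !seriesEnat /= big_split.
apply: is_cvgD; last exact: condA_sub1 cA.
exact: (cvg_series_shift (condA_b cA)).
Qed.

(** Write a^2 - 1 = 2 log a + w. The first part converges by (B); since 1 - 1/a <= log a <= a - 1,
    the remainder satisfies 0 <= w <= (a + 2) / a (a - 1)^2 and is summable by (A). *)
Lemma condAB_beta (R : realType) (a b : nat -> R) : (forall n, 0 < a n) ->
  condA a b -> condB a -> cvgn (series (fun n => a n ^+ 2 - 1)).
Proof.
move=> a0 cA cB; have ca := condA_a_cvg cA.
have [M M0 aM] : exists2 B, 0 <= B & forall n, `|a n| <= B.
  by apply: cvgn_bounded; exact: (cvgP _ ca).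
have [V V0 aV] : exists2 B, 0 <= B & forall n, `|(a n)^-1| <= B.
  apply: cvgn_bounded; apply: (cvgP (1^-1 : R)); apply: cvgV => //; exact: oner_neq0.
pose w n := a n ^+ 2 - 1 - 2 * ln (a n).
have cw : cvgn (series w).
  apply: (@series_le_cvg_scale _ _ (fun n => (a n - 1) ^+ 2) ((M + 2) * V)).
  - by rewrite mulr_ge0// addr_ge0.
  - move=> n; have := ln_le_sub1 (a0 n); have := sqr_ge0 (a n - 1); rewrite /w; lra.
  - by move=> n; exact: sqr_ge0.
  - move=> n; apply: (@le_trans _ _ (a n ^+ 2 - 1 - 2 * (1 - (a n)^-1))).
      by rewrite /w lerD2l lerN2 ler_wpM2l// ln_ge_sub_inv.
    have -> : a n ^+ 2 - 1 - 2 * (1 - (a n)^-1) = (a n + 2) * (a n)^-1 * (a n - 1) ^+ 2.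
      by field; rewrite gt_eqF.
    rewrite ler_wpM2r ?sqr_ge0// ler_pM//.
    + by rewrite addr_ge0// ltW.
    + by rewrite invr_ge0 ltW.
    + by rewrite lerD2r (le_trans (ler_norm _)).
    + by rewrite (le_trans (ler_norm _)).
  - exact: condA_sub1 cA.
have -> : series (fun n => a n ^+ 2 - 1) = series w \+ (fun n => 2 * series (fun n => ln (a n)) n).
  apply/funext => n; rewrite !seriesEnat /= mulr_sumr -big_split /=.
  by apply: eq_bigr => i _; rewrite /w subrK.
by apply: is_cvgD => //; apply: is_cvgMr.
Qed.

Lemma prod_expR_ln (R : realType) (a : nat -> R) n : (forall n, 0 < a n) ->
  \prod_(k < n) a k = expR (series (fun n => ln (a n)) n).
Proof.
move=> a0; elim: n => [|n IH]; first by rewrite big_ord0 seriesEnat /= big_geq// expR0.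
by rewrite big_ord_recr /= seriesSr expRD lnK ?posrE// IH.
Qed.

Lemma condB_prod_inv (R : realType) (a : nat -> R) : (forall n, 0 < a n) ->
  condB a -> cvgn (fun n => (\prod_(k < n) a k)^-1).
Proof.
move=> a0 cB.
have -> : (fun n => (\prod_(k < n) a k)^-1) =
    (fun n => expR (- series (fun n => ln (a n)) n)).
  by apply/funext => n; rewrite prod_expR_ln// expRN.
apply: (cvgP (expR (- limn (series (fun n => ln (a n)))))).
have h : (fun n => - series (fun n => ln (a n)) n) @ \oo --> - limn (series (fun n => ln (a n))).
  by apply: cvgN; exact: cB.
exact: (continuous_cvg _ (@continuous_expR R _) h).
Qed.

Lemma condB_prod_bounded (R : realType) (a : nat -> R) : (forall n, 0 < a n) ->
  condB a -> exists2 B, 0 <= B & forall n, \prod_(k < n) a k <= B.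
Proof.
move=> a0 /cvgn_bounded[B B0 HB]; exists (expR B); first exact: expR_ge0.
by move=> n; rewrite prod_expR_ln// ler_expR; apply: le_trans (ler_norm _) _; exact: HB.
Qed.

Lemma geometric_tail_cvg (R : realType) (t : nat -> R) (N : nat) (K s : R) :
  (forall n, 0 <= t n) -> 0 <= K -> 0 <= s -> s < 1 ->
  (forall j, t (N + j)%N <= K * s ^+ j) -> cvgn (series t).
Proof.
move=> t0 K0 s0 s1 ht; have p0 : 0 < 1 - s by rewrite subr_gt0.
have mono : {homo series t : i j / (i <= j)%N >-> i <= j}.
  by apply: nondecreasing_series => k _.
apply: (@bounded_series_cvg _ _ (series t N + K / (1 - s))) => // n.
apply: le_trans (mono n (N + n)%N (leq_addl _ _)) _.
have h j : series t (N + j)%N <= series t N + K * (1 - s ^+ j) / (1 - s).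
  elim: j => [|j IH]; first by rewrite addn0 expr0 subrr mulr0 mul0r addr0.
  rewrite addnS seriesSr; apply: le_trans (lerD IH (ht j)) _.
  rewrite -addrA lerD2l le_eqVlt; apply/orP; left; apply/eqP.
  by rewrite exprS; field; rewrite gt_eqF.
apply: le_trans (h n) _; rewrite lerD2l; apply: ler_wpM2r; first by rewrite invr_ge0 ltW.
have : 0 <= K * s ^+ n by rewrite mulr_ge0// exprn_ge0.
lra.
Qed.

Lemma normr_lt (R : rcfType) (z : R[i]) (r : R) : (`|z| < r%:C) = (norm z < r).
Proof. by rewrite normrE ltcR. Qed.

Lemma horner_scaled_poly (R : realType) (a b : nat -> R) n (z : R[i]) :
  (forall n, 0 < a n) ->
  (scaled_poly a b n).[z] =
    ((\prod_(k < n) a k)^-1)%:C * (map_poly (real_complex R) (scaled_monic a b n)).[z].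
Proof. by move=> a0; rewrite scaled_polyE_monic// linearZ /= hornerZ. Qed.

Lemma scaled_monic_jacobi_rec (R : realType) (a b : nat -> R) :
  jacobi_rec (fun n => b n.+1) (fun n => a n ^+ 2 - 1)
    (fun n z => (map_poly (real_complex R) (scaled_monic a b n)).[z]).
Proof.
move=> n z; rewrite horner_scaled_monicSS /=.
have -> : (a n ^+ 2 - 1)%:C = (a n)%:C ^+ 2 - 1 :> R[i] by rewrite rmorphB rmorphXn.
by ring.
Qed.

Lemma scaled_poly_uniformly_cauchy (R : realType) (a b : nat -> R) (r : R) :
  (forall n, 0 < a n) -> condA a b -> condB a -> condC b -> 0 <= r -> r < 1 ->
  uniformly_cauchy (closed_disc r) (fun n z => (scaled_poly a b n).[z]).
Proof.
move=> a0 cA cB cC r0 r1.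
set F := fun n z => (map_poly (real_complex R) (scaled_monic a b n)).[z].
(* This bounds F_0 = 1 and F_1 = 1 + z^2 - b_1 z for |z| <= 1. *)
have B0 : 0 <= 2 + `|b 0%N| by rewrite addr_ge0.
have [z zr|cF bF] := jacobi_rec_cvg (F := F) r0 r1 (cvg_series_shift cC) (condAB_beta a0 cA cB)
  (condA_kappa cA) (@scaled_monic_jacobi_rec R a b) B0.
  rewrite /F horner_scaled_monic0 horner_scaled_monic1 Normc.normc1; split.
    by have := normr_ge0 (b 0%N); lra.
  apply: le_trans (normcB _ _) _; rewrite Normc.normcM normc_real lerD//.
    apply: le_trans (le_normcD _ _) _; rewrite Normc.normc1 -[2]/(1 + 1) lerD2l.
    exact: (normcX_le1 2 r0 r1).
  rewrite -[X in _ <= X]mulr1 ler_wpM2l// -[z]expr1; exact: (normcX_le1 _ r0).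
have ci := condB_prod_inv a0 cB.
have cP : uniformly_cauchy (closed_disc r) (fun n _ => ((\prod_(k < n) a k)^-1)%:C : R[i]).
  move=> e e0; have [N HN] := cvgn_cauchy ci e0; exists N => m n Nm mn z _.
  by rewrite -rmorphB normc_real; exact: HN.
have bP : uniformly_bounded (closed_disc r) (fun n _ => ((\prod_(k < n) a k)^-1)%:C : R[i]).
  have [B BB0 HB] := cvgn_bounded ci; exists B => // n z _.
  by rewrite normc_real; exact: HB.
have := uniformly_cauchyM cP cF bP bF.
move=> H e e0; have [N HN] := H e e0; exists N => m n Nm mn z zr.
by rewrite !horner_scaled_poly//; exact: HN.
Qed.

Lemma eigenvector_orthonormal_poly (R : realType) (a b : nat -> R) (w : R[i]) n :
  (forall n, 0 < a n) ->
  let u n := (map_poly (real_complex R) (orthonormal_poly a b n)).[w] in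
  jacobi_op a b u n = w * u n.
Proof.
move=> a0 u; have an0 : a n != 0 by rewrite gt_eqF.
have := orthonormal_poly_rec b an0; rewrite /jacobi_op /u.
move: (orthonormal_poly a b n.+1) => q.
have tail : (map_poly (real_complex R)
    (if n is m.+1 then a m *: orthonormal_poly a b m else 0)).[w] =
    if n is m.+1 then (a m)%:C * (map_poly (real_complex R) (orthonormal_poly a b m)).[w] else 0.
  by case: n {an0 u} => [|m]; [rewrite rmorph0 horner0|rewrite linearZ /= hornerZ].
rewrite -tail; move: (orthonormal_poly a b n) (if n is _.+1 then _ else _) => p t.
move=> /(congr1 (fun p => (map_poly (real_complex R) p).[w])).
rewrite rmorphM /= map_polyX hornerM hornerX => ->.
by rewrite !rmorphD /= !hornerD !linearZ /= !hornerZ; ring.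
Qed.

Lemma scaled_poly_cvg0_eigenvalue (R : realType) (a b : nat -> R) (z : R[i]) :
  (forall n, 0 < a n) -> condA a b -> condB a -> condC b ->
  norm z < 1 -> z != 0 ->
  (fun n => norm (scaled_poly a b n).[z]) @ \oo --> (0 : R) ->
  jacobi_eigenvalue a b (z + z^-1).
Proof.
move=> a0 cA cB cC z1 z0 f0.
have n0 : 0 < norm z by rewrite normc_gt0.
set F := fun n z => (map_poly (real_complex R) (scaled_monic a b n)).[z].
have [B B0 PB] := condB_prod_bounded a0 cB.
have P0 n : 0 < \prod_(k < n) a k by apply: prodr_gt0.
have FE n : F n z = (\prod_(k < n) a k)%:C * (scaled_poly a b n).[z].
  by rewrite horner_scaled_poly// mulrA -rmorphM divff ?gt_eqF// mul1r.
have F0 : (fun n => norm (F n z)) @ \oo --> (0 : R).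
  apply: (@squeeze0 _ _ (fun n => B * norm (scaled_poly a b n).[z])).
  - by move=> n; exact: normc_ge0.
  - move=> n; rewrite FE (Normc.normcM (_%:C)) normc_real ler_wpM2r ?normc_ge0//.
    by rewrite ger0_norm// ltW.
  rewrite -(mulr0 B); apply: cvgM => //; exact: cvg_cst.
(* Any s strictly between |z|^2 and |z| works: F_n = O(s^n) by the decay lemma, and p_n = z^(-n) f_n
   = O((s / |z|)^n) is then square summable. *)
pose s := (norm z ^+ 2 + norm z) / 2.
have zz : norm z ^+ 2 < norm z by rewrite expr2 gtr_pMr.
have s1 : norm z ^+ 2 < s by rewrite /s; lra.
have s2 : s < norm z by rewrite /s; lra.
have s0 : 0 <= s by apply: le_trans (ltW s1); exact: sqr_ge0.
have [N [K K0 HK]] := jacobi_rec_decay z1 s1 (cvg_series_shift cC) (condAB_beta a0 cA cB)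
  (condA_kappa cA) (@scaled_monic_jacobi_rec R a b) F0.
exists (fun n => (map_poly (real_complex R) (orthonormal_poly a b n)).[z + z^-1]); split.
- have [V V0 HV] := cvgn_bounded (condB_prod_inv a0 cB).
  pose t := s / norm z; have t0 : 0 <= t by rewrite divr_ge0// ltW.
  have t1 : t < 1 by rewrite ltr_pdivrMr// mul1r.
  apply: (@geometric_tail_cvg _ _ N ((V * K / norm z ^+ N) ^+ 2) (t ^+ 2)).
  + by move=> n; exact: sqr_ge0.
  + exact: sqr_ge0.
  + exact: sqr_ge0.
  + by rewrite expr_lt1.
  + move=> j; set n := (N + j)%N.
    have -> : (map_poly (real_complex R) (orthonormal_poly a b n)).[z + z^-1] =
        (z ^+ n)^-1 * (scaled_poly a b n).[z].
      by rewrite scaled_polyE// mulKf// expf_neq0.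
    rewrite horner_scaled_poly// -/(F n z) Normc.normcM Normc.normcV normcX.
    rewrite (Normc.normcM (_%:C)) normc_real.
    rewrite -exprM mulnC exprM -exprMn ler_sqr ?nnegrE; first last.
    * by rewrite mulr_ge0 ?exprn_ge0// divr_ge0 ?exprn_ge0 ?mulr_ge0// normc_ge0.
    * by rewrite !mulr_ge0 ?normc_ge0// invr_ge0 exprn_ge0// normc_ge0.
    have -> : V * K / norm z ^+ N * t ^+ j = (norm z ^+ n)^-1 * (V * (K * s ^+ j)).
      by rewrite /t exprMn exprVn /n exprD; field; rewrite !expf_neq0// gt_eqF.
    rewrite ler_wpM2l ?invr_ge0 ?exprn_ge0 ?normc_ge0//.
    by apply: ler_pM => //; [exact: normc_ge0|exact: HK].
- by exists 0%N; rewrite /= rmorph1 hornerC oner_neq0.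
- by move=> n; exact: eigenvector_orthonormal_poly.
Qed.

Lemma scaled_poly_cvg_of_cond (R : realType) (a b : nat -> R) :
  (forall n, 0 < a n) -> condA a b -> condB a -> condC b ->
  exists2 g : R[i] -> R[i],
    cvg_unif_on_compacts [set z | `|z| < 1] (fun n z => (scaled_poly a b n).[z]) g
  & forall z : R[i], `|z| < 1 -> z != 0 ->
      ~ jacobi_eigenvalue a b (z + z^-1) -> g z != 0.
Proof.
move=> a0 cA cB cC.
exists (fun z => complex_limn (fun n => (scaled_poly a b n).[z])).
  apply/cvg_unif_on_compactsP => A cA' A1 e e0.
  have A2 z : A z -> norm z < 1 by move=> /A1 /=; rewrite -[1]/(1%:C) normr_lt.
  have [r [r0 r1 Ar]] := compact_open_disc cA' A2.
  have [N HN] := uniformly_cauchy_limn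
    (scaled_poly_uniformly_cauchy a0 cA cB cC (ltW r0) r1) e0.
  by exists N => n Nn z Az; apply: HN => //; exact: Ar.
move=> z; rewrite -[1]/(1%:C) normr_lt => z1 z0 nE; apply/negP => /eqP g0.
(* By contraposition: a zero of the limit makes z + 1/z an eigenvalue. *)
apply: nE; apply: scaled_poly_cvg0_eigenvalue => //.
apply/cvgrPdist_le => e e0.
have [N HN] := uniformly_cauchy_limn
  (scaled_poly_uniformly_cauchy a0 cA cB cC (normc_ge0 z) z1) e0.
exists N => // n Nn; rewrite /= sub0r normrN ger0_norm ?normc_ge0//.
by have := HN n Nn z (lexx _); rewrite g0 subr0.
Qed.

(** * Polynomials on circles *)

(** X^n - 1 is separable in characteristic 0, hence has n distinct roots, and these contain a
    primitive one. *)
Lemma prim_root_exists (F : numClosedFieldType) n :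
  (0 < n)%N -> exists z : F, n.-primitive_root z.
Proof.
move=> n0; have [rs Ers] := closed_field_poly_normal ('X^n - 1 : {poly F}).
rewrite (monicP _) ?monicXnsubC// scale1r in Ers.
have unity : all n.-unity_root rs.
  by apply/allP => z; rewrite -root_prod_XsubC -Ers.
have sz : (n < (size rs).+1)%N by rewrite -(size_prod_XsubC rs id) -Ers size_XnsubC.
have uniq_rs : uniq rs.
  by rewrite -separable_prod_XsubC -Ers separable_Xn_sub_1// pnatr_eq0 -lt0n.
by have /hasP[z _ pz] := has_prim_root n0 unity uniq_rs sz; exists z.
Qed.

Lemma normc_prim_root (R : rcfType) n (w : R[i]) : n.-primitive_root w -> norm w = 1.
Proof.
move=> pw; have n0 := prim_order_gt0 pw.
apply/eqP; rewrite -(@pexpr_eq1 _ _ n)// ?normc_ge0//.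
by rewrite -normcX (prim_expr_order pw) Normc.normc1.
Qed.

Lemma sum_prim_root (F : fieldType) n (w : F) m : n.-primitive_root w ->
  \sum_(j < n) (w ^+ m) ^+ j = if (n %| m)%N then n%:R else 0.
Proof.
move=> pw; case: ifPn => nm.
  have -> : w ^+ m = 1 by apply/eqP; rewrite -(prim_order_dvd pw).
  under eq_bigr => j _ do rewrite expr1n.
  by rewrite sumr_const card_ord.
have w1 : w ^+ m - 1 != 0 by rewrite subr_eq0 -(prim_order_dvd pw).
apply: (mulfI w1); rewrite -subrX1 mulr0.
by rewrite -exprM mulnC exprM (prim_expr_order pw) expr1n subrr.
Qed.

Lemma normc_sum (R : rcfType) n (f : 'I_n -> R[i]) (M : R) :
  (forall j, norm (f j) <= M) -> norm (\sum_(j < n) f j) <= n%:R * M.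
Proof.
elim: n f => [|n IH] f fM; first by rewrite big_ord0 Normc.normc0 mul0r.
rewrite big_ord_recr /= -natr1 mulrDl mul1r.
by apply: le_trans (le_normcD _ _) _; rewrite lerD// IH.
Qed.

Lemma normc_prod (R : rcfType) n (f : 'I_n -> R[i]) :
  norm (\prod_(j < n) f j) = \prod_(j < n) norm (f j).
Proof.
elim: n f => [|n IH] f; first by rewrite !big_ord0 Normc.normc1.
by rewrite !big_ord_recr /= Normc.normcM IH.
Qed.

(* Discrete Cauchy formula: averaging over the N-th roots of unity isolates one
   coefficient exactly as soon as N exceeds the degree. *)
Lemma coef_bound_circle (R : rcfType) (p : {poly R[i]}) (r M : R) (k : nat) :
  0 <= r -> (forall z, norm z = r -> norm p.[z] <= M) -> norm p`_k * r ^+ k <= M.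
Proof.
move=> r0 pM; pose n := (size p + k).+1.
have [w pw] := prim_root_exists (R[i]) (ltn0Sn (size p + k)); rewrite -/n in pw.
have w1 := normc_prim_root pw.
have kn : (k < n)%N by rewrite ltnS leq_addl.
have szn : (size p <= n)%N by rewrite ltnW// ltnS leq_addr.
(* The weight w^(j (n - k)) is w^(-jk) written with a natural exponent. *)
pose S := \sum_(j < n) p.[r%:C * w ^+ j] * w ^+ (j * (n - k)).
have SE : S = n%:R * (p`_k * r%:C ^+ k).
  rewrite /S; under eq_bigr => j _ do rewrite (horner_coef_wide _ szn) mulr_suml.
  rewrite exchange_big /= (bigD1 (Ordinal kn)) //= [X in _ + X]big1 ?addr0.
    have -> : \sum_(i < n) p`_k * (r%:C * w ^+ i) ^+ k * w ^+ (i * (n - k)) =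
       \sum_(i < n) (p`_k * r%:C ^+ k) * (w ^+ n) ^+ i.
      apply: eq_bigr => i _; rewrite exprMn -!mulrA; congr (_ * (_ * _)).
      by rewrite -!exprM -exprD -mulnDr subnKC 1?ltnW// mulnC.
    by rewrite -mulr_sumr sum_prim_root// dvdnn mulrC.
  move=> i ik; have -> : \sum_(j < n) p`_i * (r%:C * w ^+ j) ^+ i * w ^+ (j * (n - k)) =
       \sum_(j < n) (p`_i * r%:C ^+ i) * (w ^+ (i + (n - k))) ^+ j.
    apply: eq_bigr => j _; rewrite exprMn -!mulrA; congr (_ * (_ * _)).
    by rewrite -!exprM -exprD -mulnDr mulnC.
  (* Since i, k < n, the exponent i + (n - k) lies strictly between 0 and 2 n, so n divides it only
     if i = k. *)
  rewrite -mulr_sumr sum_prim_root// ifF ?mulr0//; apply/negP => /dvdnP[q Eq].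
  have ltin := ltn_ord i; have : (0 < q < 2)%N.
    by rewrite -(ltn_pmul2r (ltn0Sn (size p + k))) -(@ltn_pmul2r n q 2)// -/n -Eq; lia.
  case: q Eq => [|[|q]]// Eq _; move/eqP: ik; apply; apply/val_inj => /=; lia.
have : norm S <= n%:R * M.
  apply: normc_sum => j; rewrite Normc.normcM normcX w1 expr1n mulr1; apply: pM.
  by rewrite Normc.normcM normcX w1 expr1n mulr1 normc_real ger0_norm.
rewrite SE; have -> : n%:R = (n%:R : R)%:C :> R[i] by rewrite rmorph_nat.
rewrite !Normc.normcM normcX !normc_real ger0_norm// (ger0_norm r0).
by rewrite ler_pM2l// ltr0n.
Qed.

Lemma prod_sub_prim_root (F : fieldType) n (w x y : F) : n.-primitive_root w -> x != 0 ->
  \prod_(j < n) (y - x * w ^+ j) = y ^+ n - x ^+ n.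
Proof.
move=> pw x0; have := congr1 (fun p => x ^+ n * p.[y / x]) (factor_Xn_sub_1 pw).
rewrite /= horner_prod big_mkord hornerD hornerN hornerXn hornerC mulrBr mulr1.
rewrite -exprMn mulrCA divff// mulr1 => <-.
rewrite -[n in x ^+ n]card_ord -prodr_const -big_split /=; apply: eq_bigr => j _.
by rewrite hornerXsubC mulrBr mulrCA divff// mulr1.
Qed.

(* Multiplying over the N-th roots of unity gives
   delta^N <= 2^deg(p) |p(0)|^N for all N; then N tends to infinity. *)
Lemma min_modulus (R : realType) (p : {poly R[i]}) (r delta : R) :
  0 < r -> 0 < delta -> (forall z, norm z <= r -> p.[z] != 0) ->
  (forall z, norm z = r -> delta <= norm p.[z]) -> delta <= norm p.[0].
Proof.
move=> r0 delta0 pn0 pdelta; rewrite leNgt; apply/negP => lt_delta.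
have rC : r%:C != 0 :> R[i] by rewrite fmorph_eq0 gt_eqF.
have [s Es] := closed_field_poly_normal p.
have root_s x : x \in s -> r <= norm x.
  move=> xs; rewrite leNgt; apply/negP => /ltW/pn0; rewrite Es hornerZ.
  by rewrite mulf_eq0 negb_or => /andP[_]; rewrite -rootE root_prod_XsubC xs.
have main n : (0 < n)%N -> delta ^+ n <= 2 ^+ (size s) * norm p.[0] ^+ n.
  move=> n0; have [w pw] := prim_root_exists (R[i]) n0.
  have w1 := normc_prim_root pw.
  apply: (@le_trans _ _ (norm (\prod_(j < n) p.[r%:C * w ^+ j]))).
    rewrite normc_prod -[n in delta ^+ n]card_ord -prodr_const; apply: ler_prod => j _.
    rewrite ltW//=; apply: pdelta.
    by rewrite Normc.normcM normcX w1 expr1n mulr1 normc_real gtr0_norm.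
  have pE x : p.[x] = lead_coef p * \prod_(y <- s) (x - y).
    rewrite {1}Es hornerZ horner_prod; congr (_ * _).
    by apply: eq_bigr => y _; rewrite hornerXsubC.
  under eq_bigr => j _ do rewrite pE.
  rewrite big_split /= prodr_const card_ord exchange_big /= Normc.normcM.
  rewrite pE (Normc.normcM (lead_coef p)) exprMn normcX mulrCA.
  rewrite ler_wpM2l ?exprn_ge0 ?normc_ge0//.
  elim: s root_s {Es pE} => [|y s IH] root_s.
    by rewrite !big_nil Normc.normc1 expr1n mul1r.
  rewrite !big_cons !Normc.normcM exprMn /= exprS.
  (* Each root y of p contributes |y^n - r^n| <= 2 |y|^n, because r <= |y|; hence one factor 2 per
     root. *)
  have -> : \prod_(j < n) (r%:C * w ^+ j - y) = (-1) ^+ n * (y ^+ n - r%:C ^+ n).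
    rewrite -(prod_sub_prim_root y pw rC) -[n in (-1) ^+ n]card_ord -prodr_const -big_split.
    by apply: eq_bigr => j _; rewrite /= mulN1r opprB.
  have yr : r <= norm y by apply: root_s; rewrite mem_head.
  rewrite mulrACA; apply: ler_pM; rewrite ?normc_ge0//; last first.
    by apply: IH => x xs; apply: root_s; rewrite in_cons xs orbT.
  rewrite Normc.normcM normcX normcN Normc.normc1 expr1n mul1r sub0r normcN.
  apply: le_trans (normcB _ _) _; rewrite !normcX normc_real gtr0_norm// mulr_natl mulr2n.
  by rewrite lerD2l lerXn2r// nnegrE ?normc_ge0// ltW.
have t1 : `|norm p.[0] / delta| < 1.
  by rewrite ger0_norm ?divr_ge0 ?normc_ge0 ?ltW// ltr_pdivrMr// mul1r.
have e0 : 0 < (2 ^+ size s)^-1 :> R by rewrite invr_gt0 exprn_gt0.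
have [N _ HN] : \forall n \near \oo, `|0 - (norm p.[0] / delta) ^+ n| < (2 ^+ size s)^-1.
  by move/cvgrPdist_lt: (cvg_expr t1); apply.
have := HN N.+1 (leqnSn N); rewrite /= sub0r normrN ger0_norm; last first.
  by rewrite exprn_ge0// divr_ge0 ?normc_ge0// ltW.
have := main N.+1 (ltn0Sn N).
rewrite expr_div_n ltr_pdivrMr ?exprn_gt0// ltr_pdivlMl ?exprn_gt0// => h1 h2.
by have := le_lt_trans h1 h2; rewrite ltxx.
Qed.

(** * Uniform limits of polynomials on compact sets *)

Lemma horner_continuous (K : numFieldType) (p : {poly K}) : continuous (horner p).
Proof.
elim/poly_ind: p => [|p c IH] x.
  have -> : horner (0 : {poly K}) = cst 0 by apply/funext => y; rewrite horner0.
  exact: cst_continuous.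
have -> : horner (p * 'X + c%:P) = (fun y => p.[y] * y + c).
  by apply/funext => y; rewrite hornerMXaddC.
exact: (cvgD (cvgM (IH x) cvg_id) (cvg_cst c)).
Qed.

Lemma uniform_limit_horner (K : numFieldType) (A : set K) (p : nat -> {poly K}) (g : K -> K) :
  {uniform A, (fun n => horner (p n)) @ \oo --> g} -> {within A, continuous g}.
Proof.
apply: uniform_limit_continuous_subspace.
exists 0%N => // n _ /=; apply: continuous_subspaceT => x.
exact: horner_continuous.
Qed.

(** The limit is continuous, so |g| has a positive minimum on the compact set, and half of it
    survives for the late p_n. *)
Lemma poly_uniform_limit_lower (R : realType) (p : nat -> {poly R[i]})
    (g : R[i] -> R[i]) (A : set R[i]) :
  compact (A : set (complex_num R)) -> A !=set0 ->
  (forall e : R, 0 < e -> exists N, forall n, (N <= n)%N ->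
     forall z, A z -> norm ((p n).[z] - g z) <= e) ->
  (forall z, A z -> g z != 0) ->
  exists2 delta : R, 0 < delta & exists N, forall n, (N <= n)%N ->
    forall z, A z -> delta <= norm (p n).[z].
Proof.
move=> cA A0 pg gn0.
have cg : {within (A : set (complex_num R)), continuous (g : complex_num R -> complex_num R)}.
  apply: (@uniform_limit_horner (complex_num R) A p).
  apply/(@uniform_cvg_normP (complex_num R) A) => e.
  rewrite -[_ < e]/(0 < (e : R[i])) => /normc_gt0_real[d d0 ->].
  have [N HN] := pg (d / 2) (divr_gt0 d0 (ltr0n _ 2)).
  exists N => n Nn z Az; rewrite -[`|_|]/((norm ((p n).[z] - g z))%:C) ltcR.
  by apply: le_lt_trans (HN n Nn z Az) _; lra.
have [c cA' cmin] := @compact_EVT_min (complex_num R) R (fun z => norm (g z)) A A0 cA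
  (fun z => continuous_comp (cg z) (@normc_continuous R (g z))).
have c0 : 0 < norm (g c) by rewrite normc_gt0 gn0//; rewrite inE in cA'.
exists (norm (g c) / 2); first by rewrite divr_gt0.
have [N HN] := pg (norm (g c) / 2) (divr_gt0 c0 (ltr0n _ 2)).
exists N => n Nn z Az; have := HN n Nn z Az.
have := cmin z; rewrite inE => /(_ Az).
have := normcB_ge (g z) (p n).[z]; rewrite distcC; lra.
Qed.

Lemma eventually_bounded (R : realType) (u : nat -> R) (C : R) (N : nat) :
  (forall n, (N <= n)%N -> `|u n| <= C) ->
  exists2 B, 0 <= B & forall n, `|u n| <= B.
Proof.
move=> uC; exists (`|C| + \sum_(k < N) `|u k|).
  by rewrite addr_ge0// sumr_ge0.
move=> n; case: (leqP N n) => nN.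
  by rewrite (le_trans (uC n nN))// (le_trans (ler_norm C))// lerDl sumr_ge0.
rewrite (bigD1 (Ordinal nN)) //= addrCA lerDl addr_ge0// sumr_ge0//.
Qed.

(* Dividing the recursion at a real point x by u (n+1) bounds
   a (n+1) u (n+2) / u (n+1) + a n x^2 u n / u (n+1); adding the relations at x
   and -x removes b. *)
Lemma real_rec_bounded (R : realType) (a b u v : nat -> R) (r l m : R) :
  0 < r -> (forall n, 0 < a n) ->
  u @ \oo --> l -> l != 0 -> v @ \oo --> m -> m != 0 ->
  (forall n, a n.+1 * u n.+2 = (1 + r ^+ 2 - b n.+1 * r) * u n.+1 - a n * r ^+ 2 * u n) ->
  (forall n, a n.+1 * v n.+2 = (1 + r ^+ 2 + b n.+1 * r) * v n.+1 - a n * r ^+ 2 * v n) ->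
  exists2 C, 0 <= C & forall n, a n <= C /\ `|b n| <= C.
Proof.
move=> r0 a0 ul l0 vm m0 ru rv.
have ratio (w : nat -> R) (k : R) : w @ \oo --> k -> k != 0 ->
    exists N, forall n, (N <= n)%N ->
      [/\ w n != 0, 1 / 2 <= w n.+1 / w n & 1 / 2 <= w n / w n.+1].
  move=> wk k0.
  have wSk : (fun n => w n.+1) @ \oo --> k by rewrite (cvg_shiftS w).
  have h1 : (fun n => w n.+1 / w n) @ \oo --> (1 : R).
    by rewrite -(divff k0); apply: cvgM => //; exact: cvgV.
  have h2 : (fun n => w n / w n.+1) @ \oo --> (1 : R).
    by rewrite -(divff k0); apply: cvgM => //; exact: cvgV.
  have half : 1 / 2 < 1 :> R by lra.
  have [N1 _ H1] : \forall n \near \oo, 1 / 2 < w n.+1 / w n by exact: (cvgr_gt 1 h1).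
  have [N2 _ H2] : \forall n \near \oo, 1 / 2 < w n / w n.+1 by exact: (cvgr_gt 1 h2).
  exists (maxn N1 N2) => n; rewrite geq_max => /andP[n1 n2].
  have := H1 n n1; have := H2 n n2 => /= k1 k2; split; [|exact: ltW|exact: ltW].
  by apply/negP => /eqP w0; move: k1; rewrite w0 mul0r; lra.
have [N1 H1] := ratio u l ul l0; have [N2 H2] := ratio v m vm m0.
have est n : (maxn N1 N2 <= n)%N ->
    a n.+1 <= 2 * (1 + r ^+ 2) /\ `|b n.+1| <= (1 + r ^+ 2) / r.
  rewrite geq_max => /andP[n1 n2].
  have [un h1 h2] := H1 n n1; have [un1 h3 _] := H1 n.+1 (leqW n1).
  have [vn k1 k2] := H2 n n2; have [vn1 k3 _] := H2 n.+1 (leqW n2).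
  have eu : a n.+1 * (u n.+2 / u n.+1) = 1 + r ^+ 2 - b n.+1 * r - a n * r ^+ 2 * (u n / u n.+1).
    by rewrite mulrA ru; field.
  have ev : a n.+1 * (v n.+2 / v n.+1) = 1 + r ^+ 2 + b n.+1 * r - a n * r ^+ 2 * (v n / v n.+1).
    by rewrite mulrA rv; field.
  have ar : 0 <= a n * r ^+ 2 by rewrite mulr_ge0 ?sqr_ge0// ltW.
  have aS := ltW (a0 n.+1).
  have p1 : 0 <= a n * r ^+ 2 * (u n / u n.+1) by rewrite mulr_ge0//; lra.
  have p2 : 0 <= a n * r ^+ 2 * (v n / v n.+1) by rewrite mulr_ge0//; lra.
  have p3 := ler_wpM2l aS h3; have p4 := ler_wpM2l aS k3.
  (* Adding [eu] and [ev] cancels b. Each of them alone bounds b from one side, as its left side and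
     its last product are nonnegative. *)
  split; first by lra.
  by rewrite ler_pdivlMr// -[X in _ * X](gtr0_norm r0) -normrM ler_norml; apply/andP; split; lra.
have [B1 B10 HB1] : exists2 B, 0 <= B & forall n, `|a n| <= B.
  apply: (@eventually_bounded _ _ (2 * (1 + r ^+ 2)) (maxn N1 N2).+1) => -[|n]// Nn.
  by rewrite gtr0_norm//; have [] := est n Nn.
have [B2 B20 HB2] : exists2 B, 0 <= B & forall n, `|b n| <= B.
  apply: (@eventually_bounded _ _ ((1 + r ^+ 2) / r) (maxn N1 N2).+1) => -[|n]// Nn.
  by have [] := est n Nn.
exists (B1 + B2); first exact: addr_ge0.
move=> n; split.
  by apply: le_trans (ler_norm _) _; apply: le_trans (HB1 n) _; rewrite lerDl.
by apply: le_trans (HB2 n) _; rewrite lerDr.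
Qed.

(** The bound |F_{n+1}| >= |F_n| / 2 reproduces itself: it makes the last term of the recursion at
    most 2 C^2 r^2 |F_{n+1}|, and the condition on r leaves 1/2. The disc does not depend on n. *)
Lemma scaled_monic_zero_free (R : realType) (a b : nat -> R) (C r : R) (z : R[i]) :
  (forall n, 0 < a n) -> 0 <= C -> (forall n, a n <= C /\ `|b n| <= C) ->
  0 <= r -> r ^+ 2 + C * r + 2 * C ^+ 2 * r ^+ 2 <= 1 / 2 -> norm z <= r ->
  forall n, (map_poly (real_complex R) (scaled_monic a b n)).[z] != 0.
Proof.
move=> a0 C0 abC r0 rC zr.
pose F n := (map_poly (real_complex R) (scaled_monic a b n)).[z].
have z2 : norm (z ^+ 2) <= r ^+ 2 by rewrite normcX ler_sqr ?nnegrE ?normc_ge0.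
have lead n : 1 - r ^+ 2 - C * r <= norm (1 + z ^+ 2 - (b n)%:C * z).
  have h1 := normcB_ge (1 + z ^+ 2) ((b n)%:C * z).
  have h2 := normcD_ge 1 (z ^+ 2); rewrite Normc.normc1 in h2.
  have h3 : norm ((b n)%:C * z) <= C * r.
    by rewrite Normc.normcM normc_real ler_pM ?normc_ge0//; have [] := abC n.
  lra.
have CC : 0 <= C ^+ 2 * r ^+ 2 by rewrite mulr_ge0 ?sqr_ge0.
have H n : norm (F n) / 2 <= norm (F n.+1) /\ 0 < norm (F n).
  elim: n => [|n [IH1 IH2]].
    rewrite /F horner_scaled_monic0 horner_scaled_monic1 Normc.normc1; split=> //.
    have := lead 0%N; lra.
  have F1 : 0 < norm (F n.+1) by apply: lt_le_trans IH1; rewrite divr_gt0.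
  split=> //; rewrite [F n.+2]horner_scaled_monicSS -/(F n.+1) -/(F n).
  have h1 := normcB_ge ((1 + z ^+ 2 - (b n.+1)%:C * z) * F n.+1) ((a n)%:C ^+ 2 * z ^+ 2 * F n).
  have h2 : (1 - r ^+ 2 - C * r) * norm (F n.+1) <=
      norm ((1 + z ^+ 2 - (b n.+1)%:C * z) * F n.+1).
    by rewrite (Normc.normcM _ (F n.+1)) ler_wpM2r ?normc_ge0.
  have h3 : norm ((a n)%:C ^+ 2 * z ^+ 2 * F n) <= C ^+ 2 * r ^+ 2 * (2 * norm (F n.+1)).
    rewrite (Normc.normcM _ (F n)); apply: ler_pM; rewrite ?normc_ge0//; last by lra.
    rewrite Normc.normcM ler_pM ?normc_ge0// normcX normc_real ler_sqr ?nnegrE//.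
    by rewrite gtr0_norm//; have [] := abC n.
  have : (r ^+ 2 + C * r + 2 * C ^+ 2 * r ^+ 2) * norm (F n.+1) <= 1 / 2 * norm (F n.+1).
    by rewrite ler_wpM2r ?normc_ge0.
  lra.
by move=> n; rewrite -normc_gt0; have [] := H n.
Qed.

(** * From convergence to the conditions *)

Lemma coef_scaled_monicS (R : realType) (a b : nat -> R) n k :
  (scaled_monic a b n.+1)`_k =
    (if (k < 2)%N then 0 else (scaled_monic a b n)`_(k - 2)) + (scaled_monic a b n)`_k
    - b n * (if k is j.+1 then (scaled_monic a b n)`_j else 0)
    - (if n is m.+1 then a m ^+ 2 * (if (k < 2)%N then 0 else (scaled_monic a b m)`_(k - 2))
       else 0).
Proof.
rewrite [scaled_monic a b n.+1]/= coefB mulrBl mulrDl mul1r coefB coefD coefXnM.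
rewrite -scalerAl coefZ coefXM; congr (_ + _ - _ * _ - _); first by case: k.
by case: n => [|m]; rewrite ?coef0// coefZ coefXnM.
Qed.

Lemma coef0_scaled_monic (R : realType) (a b : nat -> R) n : (scaled_monic a b n)`_0 = 1.
Proof.
elim: n => [|n IH]; first by rewrite coef1.
rewrite coef_scaled_monicS /= IH; case: n {IH} => [|n]; by rewrite ?mulr0 ?subr0 add0r.
Qed.

Lemma coef1_scaled_monic (R : realType) (a b : nat -> R) n :
  (scaled_monic a b n)`_1 = - series b n.
Proof.
elim: n => [|n IH]; first by rewrite coef1 seriesEnat /= big_geq// oppr0.
rewrite coef_scaled_monicS /= IH coef0_scaled_monic seriesSr.
by case: n {IH} => [|n]; ring.
Qed.

(** The last summand is the second elementary symmetric function of b_1, ..., b_{n+1}, written with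
    power sums so that the sum of the b_k^2 appears. Only n of the a_k enter. *)
Lemma coef2_scaled_monic (R : realType) (a b : nat -> R) n :
  (scaled_monic a b n.+1)`_2 =
    1 - series (fun n => a n ^+ 2 - 1) n
    + (series b n.+1 ^+ 2 - series (fun n => b n ^+ 2) n.+1) / 2.
Proof.
elim: n => [|n IH].
  rewrite coef_scaled_monicS /= !coef1 /= !seriesSr !seriesEnat /= !big_geq//.
  by field.
have c0 := coef0_scaled_monic a b n.+1; have c1 := coef1_scaled_monic a b n.+1.
rewrite coef_scaled_monicS; move: (scaled_monic a b n.+1) IH c0 c1 => p /= -> c0 c1.
by rewrite c0 c1 coef0_scaled_monic !seriesSr; field.
Qed.

Lemma scaled_poly_coef_cvg (R : realType) (a b : nat -> R) (r : R) k :
  (forall n, 0 < a n) -> 0 < r ->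
  (forall e : R, 0 < e -> exists N, forall m n, (N <= m)%N -> (m <= n)%N ->
     forall z, norm z = r -> norm ((scaled_poly a b n).[z] - (scaled_poly a b m).[z]) <= e) ->
  cvgn (fun n => (\prod_(i < n) a i)^-1 * (scaled_monic a b n)`_k).
Proof.
move=> a0 r0 H; apply: cauchy_cvgn => e e0.
have rk : 0 < r ^+ k by rewrite exprn_gt0.
have [N HN] := H _ (mulr_gt0 e0 rk); exists N => m n Nm mn.
have h := @coef_bound_circle R (scaled_poly a b n - scaled_poly a b m) r (e * r ^+ k) k (ltW r0).
rewrite -(ler_pM2r rk); apply: le_trans (h _); last first.
  by move=> z zr; rewrite hornerD hornerN; exact: HN.
have E l : (scaled_poly a b l)`_k = ((\prod_(i < l) a i)^-1 * (scaled_monic a b l)`_k)%:C.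
  by rewrite scaled_polyE_monic// coef_map coefZ.
by rewrite coefB !E -rmorphB normc_real.
Qed.

(** The bound [delta] makes the limit of 1 / (a_1 ... a_n) non-zero, so it can be divided out of the
    coefficients and its logarithm taken. *)
Lemma cond_of_coef_cvg (R : realType) (a b : nat -> R) (delta : R) :
  (forall n, 0 < a n) -> 0 < delta ->
  (exists N, forall n, (N <= n)%N -> delta <= (\prod_(i < n) a i)^-1) ->
  (forall k, cvgn (fun n => (\prod_(i < n) a i)^-1 * (scaled_monic a b n)`_k)) ->
  [/\ condA a b, condB a & condC b].
Proof.
move=> a0 delta0 [N HN] ck.
pose A n := (\prod_(i < n) a i)^-1.
have P0 n : 0 < \prod_(i < n) a i by apply: prodr_gt0.
have cA : cvgn A.
  have -> : A = (fun n => A n * (scaled_monic a b n)`_0).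
    by apply/funext => n; rewrite coef0_scaled_monic mulr1.
  exact: ck.
have L0 : limn A != 0.
  rewrite gt_eqF//; apply: lt_le_trans delta0 _.
  by apply: limr_ge => //; exists N.
have L1 : 0 < limn A.
  rewrite lt_def L0 /=; apply: limr_ge => //; exists 0%N => // n _.
  by rewrite invr_ge0 ltW.
have cV : cvgn (fun n => (A n)^-1) by apply: is_cvgV.
have coefE k : (fun n => (scaled_monic a b n)`_k) =
    (fun n => (A n * (scaled_monic a b n)`_k) * (A n)^-1).
  by apply/funext => n; rewrite mulrAC divff ?mul1r// invr_eq0 gt_eqF.
have cPhi k : cvgn (fun n => (scaled_monic a b n)`_k).
  by rewrite coefE; apply: is_cvgM => //; exact: ck.
have lnE n : series (fun n => ln (a n)) n = - ln (A n).
  by rewrite /A lnV ?posrE// opprK prod_expR_ln// expRK.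
have cB : condB a.
  rewrite /condB; have -> : series (fun n => ln (a n)) = (fun n => - ln (A n)).
    by apply/funext => n; exact: lnE.
  apply: is_cvgN; apply: (cvgP (ln (limn A))).
  exact: (continuous_cvg _ (continuous_ln L1) cA).
have cC : condC b.
  rewrite /condC; have -> : series b = (fun n => - (scaled_monic a b n)`_1).
    by apply/funext => n; rewrite coef1_scaled_monic opprK.
  exact: is_cvgN.
split => //.
have [B1 B10 HB1] := cvgn_bounded (cPhi 2%N).
have [B2 B20 HB2] := cvgn_bounded cC.
have [B3 B30 HB3] := cvgn_bounded cB.
(* The second coefficient bounds the sums of a^2 - 1 + b^2 / 2 by 1 + B2^2 / 2 + B1, and subtracting
   2 log a costs 2 B3. The outer 2 compensates the half in b^2 / 2. *)
apply: (@bounded_series_cvg _ _ (2 * (1 + B2 ^+ 2 / 2 + B1 + 2 * B3))).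
  by move=> n; rewrite addr_ge0 ?sqr_ge0.
move=> n; have e2 := coef2_scaled_monic a b n.
pose w n := a n ^+ 2 - 1 - 2 * ln (a n) + b n ^+ 2 / 2.
have h1 : series (fun n => `|a n - 1| ^+ 2 + `|b n| ^+ 2) n <= 2 * series w n.
  rewrite !seriesEnat /= mulr_sumr; apply: ler_sum => i _.
  rewrite !real_normK ?num_real// /w.
  by have := ln_le_sub1 (a0 i); have := sqr_ge0 (a i - 1); lra.
have h2 : series w n = series (fun n => a n ^+ 2 - 1) n - 2 * series (fun n => ln (a n)) n
    + series (fun n => b n ^+ 2) n / 2.
  rewrite !seriesEnat /= mulr_sumr mulr_suml -sumrB -big_split /=.
  by apply: eq_bigr.
(* Coefficient n + 1 involves one more b than a; the extra square is dropped. *)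
have h3 : series (fun n => b n ^+ 2) n <= series (fun n => b n ^+ 2) n.+1.
  by rewrite seriesSr lerDl sqr_ge0.
have h4 : series b n.+1 ^+ 2 <= B2 ^+ 2.
  by rewrite -[X in X <= _]real_normK ?num_real// ler_sqr ?nnegrE.
have := HB1 n.+1; have := HB3 n; rewrite !ler_norml => /andP[h5 _] /andP[h6 _].
lra.
Qed.

Lemma cond_of_scaled_poly_cvg (R : realType) (a b : nat -> R) (eps : R) (g : R[i] -> R[i]) :
  (forall n, 0 < a n) -> 0 < eps ->
  cvg_unif_on_compacts [set z | 0 < `|z| < eps%:C] (fun n z => (scaled_poly a b n).[z]) g ->
  (forall z : R[i], 0 < `|z| < eps%:C -> g z != 0) ->
  [/\ condA a b, condB a & condC b].
Proof.
move=> a0 eps0 /cvg_unif_on_compactsP fg g0.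
have inD (z : R[i]) : (0 < `|z| < eps%:C) = (0 < norm z < eps).
  by rewrite normr_lt normrE -[0]/(0%:C) ltcR.
have circ (r : R) : 0 < r -> r < eps -> forall e : R, 0 < e ->
    exists N, forall n, (N <= n)%N ->
    forall z, norm z = r -> norm ((scaled_poly a b n).[z] - g z) <= e.
  move=> r0 reps; apply: (fg [set z | norm z = r]); first exact: compact_circle.
  by move=> z /= zr; rewrite inD zr r0.
pose r1 := eps / 2; have r10 : 0 < r1 by rewrite divr_gt0.
have r1e : r1 < eps by rewrite /r1; lra.
have P0 n : 0 < \prod_(i < n) a i by apply: prodr_gt0.
pose phi n : {poly R} := (\prod_(k < n) a k)^-1 *: scaled_monic a b n.
have phiE n x : (scaled_poly a b n).[x%:C] = ((phi n).[x])%:C.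
  by rewrite scaled_polyE_monic// horner_map.
have real_lim x : `|x| = r1 -> exists2 l : R, (fun n => (phi n).[x]) @ \oo --> l & l != 0.
  move=> xr; have xn : norm x%:C = r1 by rewrite normc_real.
  (* f_n is real at real points, so |Im g| is at most the distance from f_n to g, for every n. *)
  have gx : g x%:C = (complex.Re (g x%:C))%:C.
    have : complex.Im (g x%:C) = 0.
      apply/eqP; rewrite -normr_le0; apply/ler_addgt0Pr => e e0; rewrite add0r.
      have [N HN] := circ r1 r10 r1e e e0.
      apply: le_trans (HN N (leqnn _) x%:C xn); rewrite phiE -[X in norm X]opprB normcN.
      apply: le_trans (Im_le_normc _); rewrite le_eqVlt; apply/orP; left; apply/eqP.
      by case: (g x%:C) => p q /=; rewrite oppr0 addr0.
    by case: (g x%:C) => p q /= ->.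
  exists (complex.Re (g x%:C)).
    apply/cvgrPdist_le => e e0; have [N HN] := circ r1 r10 r1e e e0.
    exists N => // n Nn /=; have := HN n Nn x%:C xn.
    by rewrite phiE gx -rmorphB normc_real distrC.
  have := g0 x%:C; rewrite inD xn r10 r1e gx => /(_ isT).
  by rewrite fmorph_eq0.
have phi_rec n x : a n.+1 * (phi n.+2).[x] =
    (1 + x ^+ 2 - b n.+1 * x) * (phi n.+1).[x] - a n * x ^+ 2 * (phi n).[x].
  have E : scaled_monic a b n.+2 = ('X^2 + 1 - b n.+1 *: 'X) * scaled_monic a b n.+1
      - (a n ^+ 2) *: ('X^2 * scaled_monic a b n) by [].
  rewrite /phi E; move: (scaled_monic a b n.+1) (scaled_monic a b n) => p q.
  rewrite !big_ord_recr /= !(hornerXn, hornerX, hornerC, hornerD, hornerN, hornerM, hornerZ).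
  by field; rewrite !gt_eqF// prodr_gt0.
have [l ul l0] := real_lim r1 (gtr0_norm r10).
have r1N : `|- r1| = r1 by rewrite normrN gtr0_norm.
have [m um m0] := real_lim (- r1) r1N.
have [n|n|C C0 abC] := real_rec_bounded (b := b) r10 a0 ul l0 um m0.
- exact: phi_rec.
- by rewrite phi_rec sqrrN mulrN opprK.
have den0 : 0 < 2 * (1 + C + 2 * C ^+ 2).
  by rewrite mulr_gt0// ltr_wpDr ?mulr_ge0 ?sqr_ge0// ltr_wpDr.
(* The bound [r1] keeps the circle in the region of convergence, 1 gives r^2 <= r, and the last
   bound gives (1 + C + 2 C^2) r <= 1/2. *)
pose r := Num.min (Num.min r1 1) (2 * (1 + C + 2 * C ^+ 2))^-1.
have r0 : 0 < r by rewrite !lt_min r10 ltr01 invr_gt0.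
have rr1 : r <= r1 by rewrite /r !ge_min lexx.
have r_1 : r <= 1 by rewrite /r !ge_min lexx orbT.
have r_den : r <= (2 * (1 + C + 2 * C ^+ 2))^-1 by rewrite /r ge_min lexx orbT.
have reps : r < eps := le_lt_trans rr1 r1e.
have rC : r ^+ 2 + C * r + 2 * C ^+ 2 * r ^+ 2 <= 1 / 2.
  move: r_den; rewrite -[X in _ <= X]mul1r ler_pdivlMr// => r_den.
  have r2 : r ^+ 2 <= r by rewrite expr2 ger_pMl.
  have : C ^+ 2 * r ^+ 2 <= C ^+ 2 * r by rewrite ler_wpM2l ?sqr_ge0.
  lra.
have nz n (z : R[i]) : norm z <= r -> (scaled_poly a b n).[z] != 0.
  move=> zr; rewrite horner_scaled_poly// mulf_neq0//.
    by rewrite fmorph_eq0 invr_eq0 gt_eqF.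
  exact: (scaled_monic_zero_free a0 C0 abC (ltW r0) rC zr).
have circr := circ r r0 reps.
have [delta delta0 [N HN]] : exists2 delta : R, 0 < delta & exists N, forall n, (N <= n)%N ->
    forall z, [set z | norm z = r] z -> delta <= norm (scaled_poly a b n).[z].
  apply: (@poly_uniform_limit_lower _ _ g) => //.
  - exact: compact_circle.
  - by exists r%:C; apply: etrans (normc_real r) _; exact: gtr0_norm.
  - by move=> z /= zr; apply: g0; rewrite inD zr r0.
apply: (@cond_of_coef_cvg _ _ _ delta) => //.
  exists N => n Nn; have := min_modulus r0 delta0 (nz n) (HN n Nn).
  rewrite horner_scaled_poly// horner_coef0 coef_map coef0_scaled_monic mulr1.
  by rewrite normc_real gtr0_norm// invr_gt0.
move=> k; apply: (@scaled_poly_coef_cvg _ _ _ r) => // e e0.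
have [M HM] := circr (e / 2) (divr_gt0 e0 (ltr0n _ 2)).
exists M => i j Mi ij z zr.
have -> : (scaled_poly a b j).[z] - (scaled_poly a b i).[z] =
  ((scaled_poly a b j).[z] - g z) - ((scaled_poly a b i).[z] - g z) by ring.
apply: le_trans (normcB _ _) _.
have := HM i Mi z zr; have := HM j (leq_trans Mi ij) z zr; lra.
Qed.

Theorem theorem3p1 (R : realType) (a b : nat -> R) (a_gt0 : forall n, 0 < a n) :
  ((exists2 eps : R, 0 < eps &
      exists2 g : R[i] -> R[i],
        cvg_unif_on_compacts [set z | 0 < `|z| < eps%:C]
          (fun n z => (scaled_poly a b n).[z]) g
        & forall z : R[i], 0 < `|z| < eps%:C -> g z != 0) ->
    [/\ condA a b, condB a & condC b])
  /\
  (condA a b -> condB a -> condC b ->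
    exists2 g : R[i] -> R[i],
      cvg_unif_on_compacts [set z | `|z| < 1]
        (fun n z => (scaled_poly a b n).[z]) g
      & forall z : R[i], `|z| < 1 -> z != 0 ->
          ~ jacobi_eigenvalue a b (z + z^-1) -> g z != 0).
Proof.
split=> [[eps eps0 [g fg g0]]|]; last exact: scaled_poly_cvg_of_cond.
exact: cond_of_scaled_poly_cvg eps0 fg g0.
Qed.
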